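(* For any $N>1$, there is a minimal rank-$1$ subshift whose topological rank is at least $N$.
   Context: $2^{\mathbb{Z}}=\{0,1\}^{\mathbb{Z}}$ has the product topology, $\sigma(x)(n)=x(n+1)$. A subshift (closed $X\subseteq2^{\mathbb{Z}}$ with $\sigma X=X$) is minimal if every orbit is dense. Rank-$1$ subshifts: Given integers $r_n>1$ ($n\ge0$) and nonnegative integers $s_{n,i}$ ($n\ge0$, $1\le i<r_n$), define $v_0=0$ and $v_{n+1}=v_n1^{s_{n,1}}v_n\cdots v_n1^{s_{n,r_n-1}}v_n$ (with $r_n$ copies of $v_n$). The infinite word $V=\lim_nv_n$ is a rank-$1$ word, and $X_V=\{x\in2^{\mathbb{Z}}:$ every finite subword of $x$ is a subword of $V\}$, with $\sigma$, is a rank-$1$ subshift. Topological rank: A Cantor system $(X,T)$ is a homeomorphism $T$ of a Cantor space $X$ (zero-dimensional, perfect, compact metrizable); it is essentially minimal if it has a unique minimal set (nonempty closed set $Y$ with $TY=Y$, minimal among such sets). Systems $(X,T)$ and $(Y,S)$ are conjugate if there is a homeomorphism $\varphi:X\to Y$ with $\varphi T=S\varphi$. A Bratteli diagram $(V,E)$ consists of vertices $V=V_0\sqcup V_1\sqcup\cdots$ and edges $E=E_1\sqcup E_2\sqcup\cdots$, all $V_n,E_n$ finite nonempty, $V_0=\{v_0\}$, with maps $\mathsf{s},\mathsf{r}:E\to V$ satisfying $\mathsf{s}(E_n)=V_{n-1}$ and $\mathsf{r}(E_n)=V_n$ for $n\ge1$ (so every vertex is a source, and every vertex other than $v_0$ is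 a range). It is ordered if it carries a partial order $\preceq$ on $E$ in which $e,e'$ are comparable iff $\mathsf{r}(e)=\mathsf{r}(e')$. Let $X_B=\{(e_n)_{n\ge1}: e_n\in E_n,\ \mathsf{r}(e_n)=\mathsf{s}(e_{n+1})\}$ with the subspace topology of $\prod_n E_n$. The ordered diagram $B$ is essentially simple if there is a unique $x_{\max}\in X_B$ all of whose edges are $\preceq$-maximal and a unique $x_{\min}\in X_B$ all of whose edges are $\preceq$-minimal. Then the Vershik map $\lambda_B$ sends $x_{\max}$ to $x_{\min}$, and sends $(e_1,e_2,\dots)\ne x_{\max}$ to $(f_1,\dots,f_k,e_{k+1},\dots)$, where $k$ is least with $e_k$ not maximal, $f_k$ is the $\preceq$-successor of $e_k$, and $(f_1,\dots,f_{k-1})$ is the unique path of minimal edges from $v_0$ to $\mathsf{s}(f_k)$. An essentially minimal Cantor system has finite topological rank if it is conjugate to some $(X_B,\lambda_B)$ with $B$ essentially simple and $(|V_n|)_{n\ge1}$ bounded by some natural number $d$; the least possible $d$ is its topological rank. *)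

(* Defs.v *)
From mathcomp Require Import all_boot all_order all_algebra.
From mathcomp Require Import all_classical all_reals topology cantor.

Set Implicit Arguments.
Unset Strict Implicit.
Unset Printing Implicit Defensive.

Import Order.TTheory GRing.Theory Num.Theory.
Local Open Scope classical_set_scope.

Definition biseq : topologicalType := prod_topology (fun _ : int => bool).

Definition shift_map (x : biseq) : biseq := fun n => x (n + 1)%R.

(* For a bijective f this is the full orbit {f^k x | k : int}. *)
Definition zorbit (X : Type) (f : X -> X) (x : X) : set X :=
  [set y | exists k : nat, iter k f x = y \/ iter k f y = x].

Definition subshift (X : set biseq) : Prop := closed X /\ shift_map @` X = X.

Definition minimal_subshift (X : set biseq) : Prop :=
  subshift X /\ forall x, X x -> X `<=` closure (zorbit shift_map x).

(* Letters 0 and 1 are [false] and [true]; the values s n 0 and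
   s n i for r n <= i are not used. *)
Fixpoint rank1_block (r : nat -> nat) (s : nat -> nat -> nat) (n : nat) :
    seq bool :=
  if n is m.+1 then
    let v := rank1_block r s m in
    v ++ flatten [seq nseq (s m i) true ++ v | i <- iota 1 (r m).-1]
  else [:: false].

Definition rank1_word (V : nat -> bool) : Prop :=
  exists (r : nat -> nat) (s : nat -> nat -> nat),
    (forall n, 1 < r n) /\
    (forall n k, k < size (rank1_block r s n) ->
       V k = nth false (rank1_block r s n) k).

Definition subword_seq (w : seq bool) (V : nat -> bool) : Prop :=
  exists k : nat, forall i, i < size w -> nth false w i = V (k + i).

Definition subword_biseq (w : seq bool) (x : biseq) : Prop :=
  exists k : int, forall i, i < size w -> nth false w i = x (k + i%:Z)%R.

Definition rank1_shift (V : nat -> bool) : set biseq :=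
  [set x | forall w, subword_biseq w x -> subword_seq w V].

Lemma rank1_shift_stable (V : nat -> bool) (x : biseq) :
  rank1_shift V x -> rank1_shift V (shift_map x).
Proof.
move=> Vx w [k xk]; apply: Vx; exists (k + 1)%R => i iw.
by rewrite xk// /shift_map addrAC.
Qed.

Definition rank1_map (V : nat -> bool) (x : rank1_shift V) : rank1_shift V :=
  exist _ (shift_map (set_val x)) (mem_set (rank1_shift_stable (set_valP x))).

Definition homeomorphism (X Y : topologicalType) (f : X -> Y) : Prop :=
  continuous f /\
  exists g : Y -> X, [/\ continuous g, cancel f g & cancel g f].

Definition metrizable (X : topologicalType) : Prop :=
  exists (R : realType) (dist : X -> X -> R),
    [/\ forall x y, dist x y = 0%R <-> x = y,
        forall x y, dist x y = dist y x,
        forall x y z, (dist x z <= dist x y + dist y z)%R &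
        forall (x : X) (A : set X), nbhs x A <->
          exists2 e : R, (0 < e)%R & [set y | (dist x y < e)%R] `<=` A].

Definition cantor_system (X : topologicalType) (f : X -> X) : Prop :=
  [/\ cantor_like X, metrizable X & homeomorphism f].

Definition invariant_closed (X : topologicalType) (f : X -> X) (Y : set X) :
    Prop :=
  [/\ closed Y, Y !=set0 & f @` Y = Y].

Definition minimal_set (X : topologicalType) (f : X -> X) (Y : set X) : Prop :=
  invariant_closed f Y /\
  forall Z, invariant_closed f Z -> Z `<=` Y -> Z = Y.

Definition essentially_minimal (X : topologicalType) (f : X -> X) : Prop :=
  exists! Y : set X, minimal_set f Y.

Definition conjugate (X Y : topologicalType) (f : X -> X) (g : Y -> Y) : Prop :=
  exists2 phi : X -> Y, homeomorphism phi & forall x, phi (f x) = g (phi x).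

(* [edge B n] is the set E_{n+1} of edges from V_n to V_{n+1}. Edges of
   different levels have different ranges, hence are incomparable, so the
   order on E is given by its restriction to each level. *)
Record ordered_bratteli := OrderedBratteli {
  vertex : nat -> finType;
  edge : nat -> finType;
  src : forall n, edge n -> vertex n;
  rng : forall n, edge n -> vertex n.+1;
  ele : forall n, rel (edge n);
  root_uniq : #|vertex 0| = 1;
  vertex_nonempty : forall n, 0 < #|vertex n|;
  edge_nonempty : forall n, 0 < #|edge n|;
  src_surj : forall n (v : vertex n), exists e, src e = v;
  rng_surj : forall n (v : vertex n.+1), exists e : edge n, rng e = v;
  ele_refl : forall n, reflexive (@ele n);
  ele_anti : forall n, antisymmetric (@ele n);
  ele_trans : forall n, transitive (@ele n);
  ele_comparable : forall n (e e' : edge n),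
    ele e e' || ele e' e <-> rng e = rng e' }.

Section Vershik.
Variable B : ordered_bratteli.

Definition edge_seq : topologicalType :=
  prod_topology (fun n => discrete_topology (edge B n)).

Definition path_set : set edge_seq :=
  [set p | forall n, rng (p n : edge B n) = src (p n.+1 : edge B n.+1)].

Definition path_edge (x : path_set) (n : nat) : edge B n := set_val x n.

Definition edge_max n (e : edge B n) : Prop := forall e', ele e e' -> e' = e.
Definition edge_min n (e : edge B n) : Prop := forall e', ele e' e -> e' = e.

Definition edge_succ n (e f : edge B n) : Prop :=
  [/\ ele e f, e <> f & forall g, ele e g -> ele g f -> g = e \/ g = f].

Definition path_max (x : path_set) : Prop := forall n, edge_max (path_edge x n).
Definition path_min (x : path_set) : Prop := forall n, edge_min (path_edge x n).

Definition essentially_simple : Prop :=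
  (exists! x, path_max x) /\ (exists! x, path_min x).

Definition vershik_step (x y : path_set) : Prop :=
  exists k, [/\ ~ edge_max (path_edge x k),
    forall i, i < k -> edge_max (path_edge x i),
    edge_succ (path_edge x k) (path_edge y k),
    forall i, i < k -> edge_min (path_edge y i) &
    forall i, k < i -> path_edge y i = path_edge x i].

(* When B is essentially simple there is exactly one such map. *)
Definition vershik_map (lambda : path_set -> path_set) : Prop :=
  forall x, (path_max x -> path_min (lambda x)) /\
            (~ path_max x -> vershik_step x (lambda x)).

End Vershik.

Arguments edge_seq : clear implicits.
Arguments path_set : clear implicits.
Arguments essentially_simple : clear implicits.

Definition topological_rank_le (X : topologicalType) (f : X -> X) (d : nat) :
    Prop :=
  [/\ cantor_system f, essentially_minimal f &
      exists (B : ordered_bratteli) (lambda : path_set B -> path_set B),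
        [/\ essentially_simple B, vershik_map lambda, conjugate f lambda &
            forall n, #|vertex B n.+1| <= d]].

Definition topological_rank (X : topologicalType) (f : X -> X) (d : nat) :
    Prop :=
  topological_rank_le f d /\ forall d', topological_rank_le f d' -> d <= d'.

(* Main.v *)
(* Put r = N + 1 and use the same N spacers 0, 1, ..., N - 1 at every stage. The
   exponents in V = 0 1^s 0 1^s ... then form a Toeplitz sequence over N letters,
   generated by the substitution of constant length r sending j to
   0 1 ... (N-1) j, and X_V is a tower over it. Because a hole of the Toeplitz
   pattern is never filled by a constant, desubstitution is unique; cutting the
   substituted words so that both ends are independent of j gives an ordered
   Bratteli diagram with N vertices at each level whose Vershik map is conjugate
   to the shift.
   Conversely, in a model with fewer than N vertices at some level, N locally
   constant functions have a nontrivial combination that sums to zero along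
   all towers of that level, so its Birkhoff sums are bounded. For the
   indicators of 0 1^j 0 with j < N no such combination exists, by the
   self-similarity of the sequence of exponents. *)

Require Import Defs.
From mathcomp Require Import all_boot all_order all_algebra.
From mathcomp Require Import all_classical all_reals topology cantor.
From mathcomp Require Import zify ring Rstruct.

Set Implicit Arguments.
Unset Strict Implicit.
Unset Printing Implicit Defensive.

Import Order.TTheory GRing.Theory Num.Theory.
Local Open Scope ring_scope.
Local Open Scope classical_set_scope.

(** * The ruler sequence and its substitution *)

(** The parameter is k = N - 2, so there are k+2 letters and r = k+3. The rank-one pattern 0, 1,
    ..., N-1, j ends in the free letter j; a diagram built on it would have N maximal paths, one for
    each constant sequence of letters. The pattern is therefore rotated to k+1, j, 0, ..., k. Its
    fixed first and last letters give the unique minimal and maximal paths, and they also widen the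
    known window by one letter on each side at every substitution, which is what makes the coding by
    paths injective. The points of X_V are not all shifts of one two-sided sequence, so the argument
    runs over the class [toeplitz], defined by its language and preserved by shifts, substitution
    and desubstitution. The diagram is needed even though only a lower bound on the rank is claimed:
    the rank is a minimum, and the diagram shows that it is finite. *)

Section Ruler.
Variable k : nat.
Local Notation r := k.+3.

(* [ruler m] is one less than the last nonzero base-r digit of [m], and 0 at 0;
   the sequence (ruler m), m > 0, lists the exponents s in V = 0 1^s 0 1^s ... *)
Fixpoint ruler_rec (n : nat) (m : int) : nat :=
  if n is n'.+1 then
    if (r%:Z %| m)%Z then ruler_rec n' (m %/ r%:Z)%Z
    else `|(m %% r%:Z)%Z|%N.-1
  else 0%N.

Definition ruler (m : int) : nat := ruler_rec `|m|%N m.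

Lemma euclid (m : int) : exists q : int, exists2 u : nat, (u < r)%N & m = r%:Z * q + u%:Z.
Proof.
exists (m %/ r%:Z)%Z, `|(m %% r%:Z)%Z|%N.
  by rewrite -ltz_nat gez0_abs ?modz_ge0// ltz_pmod.
by rewrite gez0_abs ?modz_ge0// mulrC -divz_eq.
Qed.

Lemma ruler_recM n (q : int) : ruler_rec n.+1 (r%:Z * q) = ruler_rec n q.
Proof. by rewrite /= dvdz_mulr// mulKz. Qed.

Lemma ruler_recD n (q : int) (u : nat) : (0 < u < r)%N ->
  ruler_rec n.+1 (r%:Z * q + u%:Z) = u.-1.
Proof.
move=> /andP[u0 ur].
have E : ((r%:Z * q + u%:Z) %% r%:Z)%Z = u by rewrite mulrC modzMDl modz_small.
rewrite /=; case: ifP => [/dvdz_mod0P|_]; last by rewrite E.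
by rewrite E => -[] uE; rewrite uE in u0.
Qed.

(** Division by r strictly decreases the absolute value of a nonzero multiple of r, so |m| is enough
    fuel. *)
Lemma ruler_rec_fuel n n' (m : int) : (`|m| <= n)%N -> (`|m| <= n')%N ->
  m != 0 -> ruler_rec n m = ruler_rec n' m.
Proof.
elim: n n' m => [|n IH] [|n'] m mn mn' m0; try by move: m0 mn mn'; lia.
have [q [u ur mE]] := euclid m; case: u => [|u] in ur mE *.
  have q0 : q != 0 by apply: contraNneq m0 => q0; rewrite mE q0 mulr0.
  rewrite addr0 in mE; rewrite mE !ruler_recM; apply: IH => //; nia.
by rewrite mE !ruler_recD.
Qed.

Lemma rulerM (m : int) : ruler (r%:Z * m) = ruler m.
Proof.
have [->|m0] := eqVneq m 0; first by rewrite mulr0.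
rewrite /ruler; case E: `|_|%N => [|n]; first by move: E; nia.
by rewrite ruler_recM; apply: ruler_rec_fuel => //; nia.
Qed.

Lemma rulerD (q : int) (u : nat) : (0 < u < r)%N ->
  ruler (r%:Z * q + u%:Z) = u.-1.
Proof.
move=> ur; rewrite /ruler; case E: `|_|%N => [|n]; last exact: ruler_recD.
by have [q0|q0] : 0 <= q \/ q <= -1 by [lia]; nia.
Qed.

Lemma ruler_small (u : nat) : (0 < u < r)%N -> ruler u%:Z = u.-1.
Proof. by move=> ur; rewrite -(rulerD 0 ur) mulr0 add0r. Qed.

Lemma ruler_lt (m : int) : (ruler m < k.+2)%N.
Proof.
rewrite /ruler; move: `|m|%N => n; elim: n m => [|n IH] m //=.
case: ifP => // _; have := ltz_pmod m (isT : 0 < r%:Z).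
by have := modz_ge0 m (isT : r%:Z != 0); lia.
Qed.

(** Adding r^n does not touch the last nonzero digit of t. At t = 0 the convention [ruler 0 = 0]
    matches the digit 1 of r^n, so that windows around the origin also recur at positive
    arguments. *)
Lemma ruler_expD (n : nat) (t : int) : (`|t| < r ^ n)%N ->
  ruler ((r ^ n)%N%:Z + t) = ruler t.
Proof.
elim: n t => [|n IH] t; rewrite ?expn0 ?expnS => tr.
  by have -> : t = 0; [lia|rewrite addr0 (@ruler_small 1)].
have [q [u ur tE]] := euclid t.
have E : (r * r ^ n)%N%:Z + t = r%:Z * ((r ^ n)%N%:Z + q) + u%:Z.
  by rewrite tE PoszM; ring.
rewrite E; case: u => [|u] in ur tE E *; last by rewrite tE !rulerD.
by rewrite tE !addr0 !rulerM IH//; nia.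
Qed.

Lemma ruler_expDn (n : nat) (c u : nat) : (0 < u < r ^ n)%N ->
  ruler ((c * r ^ n + u)%N%:Z) = ruler u.
Proof.
elim: n u => [|n IH] u; first by rewrite expn0; lia.
rewrite expnS => ur; have [q [v vr uE]] := euclid u.
have q0 : 0 <= q by nia.
have E : (c * (r * r ^ n) + u)%N%:Z = r%:Z * ((c * r ^ n)%N%:Z + q) + v%:Z.
  by rewrite PoszD uE !PoszM; ring.
rewrite E uE; case: v => [|v] in vr uE E *; last by rewrite !rulerD.
rewrite !addr0 !rulerM; case: q q0 uE {E} => // q _ uE.
by rewrite -PoszD IH//; nia.
Qed.

(* The rank-one pattern 0, 1, ..., k+1, j, rotated so that both its first and its
   last letter are independent of j: k+1, j, 0, 1, ..., k. *)
Definition subst_letter (j i : nat) : nat :=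
  if i == 0%N then k.+1 else if i == 1%N then j else i.-2.

(* [y] is the substituted sequence of [z], with its origin at position [i] of the
   word substituted for [z 0]. *)
Definition desubst (i : nat) (z y : int -> nat) : Prop :=
  forall (q : int) (u : nat), (u < r)%N ->
    y (r%:Z * q + u%:Z - i%:Z) = subst_letter (z q) u.

Lemma desubst_hole i z y (q : int) : desubst i z y ->
  z q = y (r%:Z * q + 1 - i%:Z).
Proof. by move=> yz; rewrite (yz q 1%N). Qed.

(* Every finite pattern of [y] occurs in [ruler] at positive arguments. *)
Definition toeplitz (y : int -> nat) : Prop :=
  forall K : nat, exists2 c : int, K%:Z < c &
    forall t : int, (`|t| <= K)%N -> y t = ruler (c + t).

Lemma toeplitz_lt y t : toeplitz y -> (y t < k.+2)%N.
Proof.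
by move=> /(_ `|t|%N)[c _ /(_ t (leqnn _)) ->]; exact: ruler_lt.
Qed.

Lemma toeplitz_shift y (a : int) : toeplitz y -> toeplitz (fun t => y (a + t)).
Proof.
move=> Ty K; have [c Kc yc] := Ty (K + `|a|)%N.
by exists (a + c) => [|t tK]; [lia|rewrite yc; [congr ruler; ring|lia]].
Qed.

Lemma toeplitz_ruler : toeplitz ruler.
Proof.
move=> K; exists (r ^ K.+1)%N%:Z => [|t tK].
  by have := ltn_expl K.+1 (isT : (1 < r)%N); lia.
by rewrite ruler_expD//; have := ltn_expl K.+1 (isT : (1 < r)%N); lia.
Qed.

(** Among r consecutive integers one is 1 and one is 2 modulo r, and [ruler] takes the values 0 and
    1 there. *)
Lemma toeplitz_nonconst y (v : nat) : toeplitz y ->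
  exists2 q : nat, (q < r)%N & y q%:Z != v.
Proof.
move=> /(_ r)[c _ yc].
have H (u : nat) : (0 < u < r)%N -> exists2 q : nat, (q < r)%N & y q%:Z = u.-1.
  move=> ur; have [p [w wr cE]] := euclid c.
  exists (if (w <= u)%N then u - w else u + r - w)%N; first by case: ifP; lia.
  rewrite yc; last by case: ifP; lia.
  case: ifP => wu.
    rewrite (_ : c + _ = r%:Z * p + u%:Z) ?rulerD//.
    by rewrite cE -subzn//; ring.
  rewrite (_ : c + _ = r%:Z * (p + 1) + u%:Z) ?rulerD//.
  by rewrite cE -subzn ?PoszD; [ring|lia].
have [/eqP ->|v0] := boolP (v == 0%N).
  by have [q qr yq] := H 2%N isT; exists q => //; rewrite yq.
by have [q qr yq] := H 1%N isT; exists q => //; rewrite yq eq_sym.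
Qed.

(** The rotated word starts one place before a multiple of r, whence c + 1: at the residues -1, 0,
    1, ..., r-2 the values of [ruler] are k+1, the hole, 0, ..., k. *)
Lemma desubst_ruler (c d : int) (i : nat) : (i < r)%N ->
  c + 1 = r%:Z * d + i%:Z ->
  desubst i (fun q => ruler (d + q)) (fun t => ruler (c + t)).
Proof.
move=> ir cE q u ur; have cE' : c = r%:Z * d + i%:Z - 1 by rewrite -cE addrK.
have -> : c + (r%:Z * q + u%:Z - i%:Z) = r%:Z * (d + q) + u%:Z - 1.
  by rewrite cE'; ring.
case: u ur => [_|[_|u ur]] /=.
- have -> : r%:Z * (d + q) + 0%:Z - 1 = r%:Z * (d + q - 1) + k.+2%:Z.
    by rewrite (_ : r = k.+2 + 1)%N ?PoszD; [ring|lia].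
  by rewrite rulerD// ltnS leqnn.
- by rewrite addrK rulerM.
- have -> : r%:Z * (d + q) + u.+2%:Z - 1 = r%:Z * (d + q) + u.+1%:Z.
    by rewrite -[u.+2]addn1 PoszD; ring.
  by rewrite rulerD//; lia.
Qed.

(** If the phases differed, the holes of [y'] would fall on a place u != 1 of the words of [y],
    where the letter is fixed, and r consecutive letters of [z'] would be equal. These r holes lie
    within distance r^2 of the origin, which explains the window. *)
Lemma desubst_phase (i i' : nat) (z z' y y' : int -> nat) :
  (i < r)%N -> (i' < r)%N -> toeplitz z' ->
  desubst i z y -> desubst i' z' y' ->
  (forall t : int, (`|t| <= r * r)%N -> y t = y' t) -> i = i'.
Proof.
move=> ir ir' Tz' yz yz' yy'; apply/eqP/negP => /negP ii'.
have [u [e [ur u1 E]]] : exists (u : nat) (e : int),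
    [/\ (u < r)%N, u != 1%N & 1 - i'%:Z = r%:Z * e + u%:Z - i%:Z].
  have [le|lt] := leqP i' (i + 1)%N; have [le2|lt2] := leqP r (i + 1 - i')%N.
  - by exists (i + 1 - i' - r)%N, 1; split; lia.
  - by exists (i + 1 - i')%N, 0; split; lia.
  - lia.
  - by exists (i + r + 1 - i')%N, (-1); split; lia.
(* Since u != 1, the letter [subst_letter 0 u] does not depend on its first argument; 0 is a
   dummy. *)
have [q qr] := toeplitz_nonconst (subst_letter 0 u) Tz'; apply/negP; rewrite negbK.
rewrite (desubst_hole _ yz').
rewrite -yy'; last by nia.
rewrite -addrA E addrA addrA -mulrDr yz// /subst_letter (negbTE u1).
by [].
Qed.

Lemma desubst_eq (i : nat) (z z' y : int -> nat) :
  desubst i z y -> desubst i z' y -> forall q, z q = z' q.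
Proof.
by move=> yz yz' q; rewrite (desubst_hole q yz) (desubst_hole q yz').
Qed.

Lemma desubst_exists (y : int -> nat) : toeplitz y ->
  exists i z, [/\ (i < r)%N, toeplitz z & desubst i z y].
Proof.
move=> Ty; have [c0 c0K yc0] := Ty (r * r)%N.
have [d0 [i ir c0E]] := euclid (c0 + 1).
(* Larger windows of [y] may occur in [ruler] at unrelated places; as soon as they contain radius
   r^2, [desubst_phase] forces them all to have the phase i of the first one. *)
have phase (K : nat) : (r * r <= K)%N -> exists c d : int,
    [/\ K%:Z < c, c + 1 = r%:Z * d + i%:Z &
        forall t : int, (`|t| <= K)%N -> y t = ruler (c + t)].
  move=> rK; have [c cK yc] := Ty K; have [d [i' ir' cE]] := euclid (c + 1).
  exists c, d; split => //; rewrite cE; congr (_ + Posz _).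
  apply: (desubst_phase ir' ir _ (desubst_ruler ir' cE) (desubst_ruler ir c0E)).
    exact: toeplitz_shift toeplitz_ruler.
  by move=> t tr; rewrite -yc// -?yc0//; lia.
exists i, (fun q => y (r%:Z * q + 1 - i%:Z)); split => //.
  move=> K; have [|c [d [cK cE yc]]] := phase (r * r + r * K)%N; first lia.
  exists d => [|t tK]; first by nia.
  rewrite yc; last by nia.
  by rewrite -(desubst_hole t (desubst_ruler ir cE)).
move=> q u ur.
have [|c [d [cK cE yc]]] := phase (r * r + r * `|q| + r)%N; first lia.
rewrite yc; last by nia.
rewrite yc; last by nia.
by rewrite -(desubst_hole q (desubst_ruler ir cE)) (desubst_ruler ir cE).
Qed.

Lemma subst_exists (i : nat) (z : int -> nat) : (i < r)%N -> toeplitz z ->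
  exists2 y, toeplitz y & desubst i z y.
Proof.
move=> ir Tz.
pose y (t : int) := subst_letter (z ((t + i%:Z) %/ r%:Z)%Z) `|((t + i%:Z) %% r%:Z)%Z|%N.
have yz : desubst i z y.
  move=> q u ur; rewrite /y subrK mulrC modzMDl divzMDl// modz_small//=.
  by rewrite divz_small// addr0.
exists y => // K; have [c cK zc] := Tz (K + r)%N.
exists (r%:Z * c + i%:Z - 1) => [|t tK]; first by nia.
have [q [u ur tE]] := euclid (t + i%:Z).
have {}tE : t = r%:Z * q + u%:Z - i%:Z by rewrite -tE addrK.
rewrite tE yz// (@desubst_ruler _ c i)//; last by ring.
by rewrite zc//; nia.
Qed.

Lemma desubst_shift (i : nat) (z y : int -> nat) :
  desubst i z y -> desubst i.+1 z (fun t => y (t + 1)).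
Proof.
by move=> yz q u ur; rewrite -(yz q u ur) -[i.+1]addn1 PoszD; congr y; ring.
Qed.

Lemma desubst_carry (z y : int -> nat) :
  desubst k.+2 z y -> desubst 0 (fun t => z (t + 1)) (fun t => y (t + 1)).
Proof.
move=> yz q u ur; rewrite -(yz (q + 1) u ur); congr y.
by rewrite (_ : r = k.+2 + 1)%N ?PoszD; [ring|lia].
Qed.

Lemma desubst_window (i : nat) (z z' y y' : int -> nat) (K : nat) :
  (i < r)%N -> desubst i z y -> desubst i z' y' ->
  (forall t : int, (`|t| <= r * K + r)%N -> y t = y' t) ->
  forall t : int, (`|t| <= K)%N -> z t = z' t.
Proof.
move=> ir yz yz' yy' t tK; rewrite (desubst_hole t yz) (desubst_hole t yz').
by apply: yy'; nia.
Qed.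

(* The gain of one letter on each side comes from the first and the last letter
   of a substituted word, which do not depend on the letter substituted. *)
Lemma desubst_grow (i : nat) (z z' y y' : int -> nat) (K : nat) :
  (i < r)%N -> desubst i z y -> desubst i z' y' ->
  (forall t : int, (`|t| <= K)%N -> z t = z' t) ->
  forall t : int, (`|t| <= K.+1)%N -> y t = y' t.
Proof.
move=> ir yz yz' zz' t tK; have [q [u ur tE]] := euclid (t + i%:Z).
have -> : t = r%:Z * q + u%:Z - i%:Z by rewrite -tE addrK.
rewrite yz// yz'//; have [qK|Kq] := leqP `|q|%N K; first by rewrite zz'.
have [u1|u1] := eqVneq u 1%N; last by rewrite /subst_letter (negbTE u1).
by exfalso; rewrite u1 in tE; nia.
Qed.

Lemma ruler_phase (c c' : int) (i i' : nat) : (i < r)%N -> (i' < r)%N ->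
  i != i' -> (r%:Z %| c + 1 - i%:Z)%Z -> (r%:Z %| c' + 1 - i'%:Z)%Z ->
  exists t, ruler (c + t) != ruler (c' + t).
Proof.
move=> ir ir' ii' /dvdzP[d cE] /dvdzP[d' cE'].
apply/not_existsP => H.
have yz : desubst i (fun q => ruler (d + q)) (fun t => ruler (c + t)).
  by apply: desubst_ruler => //; rewrite mulrC -cE subrK.
have yz' : desubst i' (fun q => ruler (d' + q)) (fun t => ruler (c' + t)).
  by apply: desubst_ruler => //; rewrite mulrC -cE' subrK.
move/eqP: ii'; apply.
apply: (desubst_phase ir ir' (toeplitz_shift d' toeplitz_ruler) yz yz').
by move=> t _; apply/eqP/negP => /negP; apply: H.
Qed.

(** [ruler] takes the value v at v+1 and at r(v+1), and these places have different phases. The two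
    translates of [ruler] are thus distinct, so at least one differs from z. This serves both the
    density of the coded paths and the perfectness of X_V. *)
Lemma toeplitz_other (z : int -> nat) (v : nat) : (v < k.+2)%N ->
  exists2 z', toeplitz z' & z' 0 = v /\ exists t, z t != z' t.
Proof.
move=> vk.
pose i := if v == k.+1 then 0%N else v.+2.
have [|||||t ne] := @ruler_phase v.+1 (r * v.+1)%N i 1%N => //.
- by rewrite /i; case: eqP; lia.
- by rewrite /i; case: ifP.
- apply/dvdzP; rewrite /i; case: eqP => [->|_]; last by exists 0; lia.
  by exists 1; lia.
- by apply/dvdzP; exists v.+1%:Z; rewrite PoszM; ring.
have [E|N] := pselect (exists t, z t != ruler (v.+1%:Z + t)).
  exists (fun t => ruler (v.+1%:Z + t)); first exact: toeplitz_shift toeplitz_ruler.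
  by split => //; rewrite addr0 ruler_small//; lia.
exists (fun t => ruler ((r * v.+1)%N%:Z + t)); first exact: toeplitz_shift toeplitz_ruler.
split; first by rewrite addr0 PoszM rulerM ruler_small//; lia.
exists t; apply: contraNneq ne => <-; rewrite eq_sym.
by apply/negPn/negP => ne; apply: N; exists t.
Qed.

(** The source of minimality: every [toeplitz] sequence contains every initial piece of [ruler]. The
    piece of length r^(n+1) is found by desubstituting once and placing t = 0 at the hole of the
    word where the piece of length r^n is anchored. *)
Lemma toeplitz_prefix (y : int -> nat) (n : nat) : toeplitz y ->
  exists a : int, forall t : nat, (0 < t < r ^ n)%N -> y (a + t%:Z) = ruler t.
Proof.
elim: n y => [|n IH] y Ty; first by exists 0 => t; rewrite expn0; lia.
have [i [z [ir Tz yz]]] := desubst_exists Ty; have [a za] := IH z Tz.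
exists (r%:Z * a + 1 - i%:Z) => t; rewrite expnS => tr.
have [q [u ur tE]] := euclid t; rewrite tE.
case: u => [|u] in ur tE *.
  rewrite addr0 rulerM.
  case: q tE => q tE; last by nia.
  rewrite -za; last by nia.
  by rewrite (desubst_hole _ yz); congr y; ring.
rewrite rulerD//.
have [ur2|ur2] := leqP u.+2 k.+2.
  rewrite (_ : u.+1.-1 = subst_letter (z (a + q)) u.+2)// -yz//; congr y.
  by rewrite -[u.+2]addn1 PoszD; ring.
(* Because of the rotation, the last digit k+2 is read off as the first letter of the next word. *)
have -> : u = k.+1 by lia.
rewrite (_ : k.+2.-1 = subst_letter (z (a + q + 1)) 0)// -yz//; congr y.
by rewrite (_ : r = k.+2 + 1)%N ?PoszD; [ring|lia].
Qed.

End Ruler.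

(** * Binary words coded by their runs of ones *)

(* [P] enumerates the zeros of [x] and [y] the numbers of ones between them. *)
Definition coding (x : int -> bool) (P : int -> int) (y : int -> nat) : Prop :=
  (forall t : int, P (t + 1) = P t + (y t).+1%:Z) /\
  (forall (t : int) (i : nat), (i <= y t)%N -> x (P t + i%:Z) = (i != 0%N)).

Lemma coding_zero x P y (t : int) : coding x P y -> x (P t) = false.
Proof. by move=> [_ /(_ t 0%N isT)]; rewrite addr0. Qed.

Lemma coding_next x P y (t : int) (n : nat) : coding x P y ->
  P (t + n.+1%:Z) = P (t + n%:Z) + (y (t + n%:Z)).+1%:Z.
Proof.
move=> [PS _]; have -> : t + n.+1%:Z = t + n%:Z + 1 by lia.
exact: PS.
Qed.

Lemma coding_mono x P y (t : int) (n : nat) : coding x P y -> P t + n%:Z <= P (t + n%:Z).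
Proof.
move=> xP; elim: n => [|n IH]; first by rewrite !addr0.
by rewrite (coding_next _ _ xP); lia.
Qed.

Lemma coding_le x P y (t t' : int) : coding x P y -> t <= t' ->
  P t + (t' - t) <= P t'.
Proof.
move=> xP tt'; have -> : t' = t + `|(t' - t)%R|%N%:Z by lia.
by have := coding_mono t `|(t' - t)%R|%N xP; lia.
Qed.

Lemma coding_cover x P y (m : int) : coding x P y ->
  exists t, exists2 i : nat, (i <= y t)%N & m = P t + i%:Z.
Proof.
move=> xP; have [PS _] := xP.
have H (n : nat) (t : int) : P t <= m -> m - P t <= n%:Z ->
    exists t, exists2 i : nat, (i <= y t)%N & m = P t + i%:Z.
  elim: n t => [|n IH] t tm mn; first by exists t, 0%N => //; lia.
  have [le|lt] := leqP `|(m - P t)%R|%N (y t).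
    by exists t, `|(m - P t)%R|%N => //; lia.
  by apply: (IH (t + 1)); rewrite PS; lia.
pose n := (`|m| + `|P 0%R|)%N.
have le : P (- n%:Z) + (0 - - n%:Z) <= P 0 by apply: coding_le xP _; lia.
by apply: (H `|(m - P (- n%:Z))%R|%N (- n%:Z)); lia.
Qed.

Lemma coding_interval x P y (t t' m : int) : coding x P y ->
  P t <= m < P (t + 1) -> P t' <= m < P (t' + 1) -> t = t'.
Proof.
move=> xP; wlog tt' : t t' / t <= t' => [W H H'|/andP[_ H] /andP[H' _]].
  by have [/W|/ltW/W] := leP t t'; [apply|move=> E; apply/esym/E].
have [//|lt] := leP t' t; first by lia.
by have : P (t + 1) + (t' - (t + 1)) <= P t' by [apply: coding_le xP _; lia]; lia.
Qed.

Lemma coding_zeroP x P y (m : int) : coding x P y -> x m = false -> exists t, m = P t.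
Proof.
move=> xP xm; have [t [i ti mE]] := coding_cover m xP; exists t.
case: xP => _ /(_ t i ti); rewrite -mE xm => /esym/negbFE/eqP i0.
by rewrite mE i0 addr0.
Qed.

(** Zeros are matched one after another: if the next runs had different lengths, the zero ending the
    shorter run would face a one of the longer run. *)
Lemma coding_sync x P y x' P' y' (a b D : int) (n : nat) :
  coding x P y -> coding x' P' y' -> P' b = P a + D ->
  (forall m : int, P a <= m <= P (a + n%:Z) -> x m = x' (m + D)) ->
  forall i : nat, (i <= n)%N -> P' (b + i%:Z) = P (a + i%:Z) + D /\
    forall j : nat, (j < i)%N -> y (a + j%:Z) = y' (b + j%:Z).
Proof.
move=> xP xP' ab xx'; elim=> [|i IH] ni; first by rewrite !addr0.
have [IH1 IH2] := IH (ltnW ni).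
have [PS Px] := xP; have [PS' Px'] := xP'.
have E : y (a + i%:Z) = y' (b + i%:Z).
  have L1 : P a + (a + i%:Z - a) <= P (a + i%:Z) by apply: coding_le xP _; lia.
  have L2 : P (a + i.+1%:Z) + (a + n%:Z - (a + i.+1%:Z)) <= P (a + n%:Z).
    by apply: coding_le xP _; lia.
  have S1 : P (a + i.+1%:Z) = P (a + i%:Z) + (y (a + i%:Z)).+1%:Z.
    exact: coding_next xP.
  have S2 : P' (b + i.+1%:Z) = P' (b + i%:Z) + (y' (b + i%:Z)).+1%:Z.
    exact: coding_next xP'.
  have [lt|lt|//] := ltngtP (y (a + i%:Z)) (y' (b + i%:Z)).
    have := xx' (P (a + i.+1%:Z)); rewrite (coding_zero _ xP) S1.
    rewrite addrAC -IH1 Px'//= => H; suff : false = true by [].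
    by apply: H; rewrite -S1; lia.
  have := xx' (P (a + i%:Z) + (y' (b + i%:Z)).+1%:Z).
  rewrite Px//= addrAC -IH1 -S2 (coding_zero _ xP') => H.
  by suff : true = false by []; apply: H; lia.
split; first by rewrite (coding_next _ _ xP) (coding_next _ _ xP') IH1 E addrAC.
by move=> j; rewrite ltnS leq_eqVlt => /predU1P[->//|]; exact: IH2.
Qed.

(** Converse of [coding_sync]: equal runs give equal words up to translation. *)
Lemma coding_transfer x P y x' P' y' (a b : int) (n : nat) :
  coding x P y -> coding x' P' y' ->
  (forall i : nat, (i < n)%N -> y (a + i%:Z) = y' (b + i%:Z)) ->
  forall m : int, P a <= m <= P (a + n%:Z) -> x m = x' (m - P a + P' b).
Proof.
move=> xP xP' yy' m mn.
have [PS Px] := xP; have [PS' Px'] := xP'.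
have D (i : nat) : (i <= n)%N -> P (a + i%:Z) - P a = P' (b + i%:Z) - P' b.
  elim: i => [|i IH] ni; first by rewrite !addr0 !subrr.
  rewrite (coding_next _ _ xP) (coding_next _ _ xP') addrAC IH 1?ltnW// yy'//.
  by rewrite addrAC.
have [t [i ti mE]] := coding_cover m xP.
have at_ : a <= t.
  have [//|lt] := leP a t.
  have : P (t + 1) + (a - (t + 1)) <= P a by apply: coding_le xP _; lia.
  by rewrite PS; lia.
have [d tE] : exists d : nat, t = a + d%:Z by exists `|(t - a)%R|%N; lia.
have [le|lt] := leqP n d.
  have L : P (a + n%:Z) + (t - (a + n%:Z)) <= P t by apply: coding_le xP _; lia.
  have mn' : m = P (a + n%:Z) by lia.
  by rewrite mn' (coding_zero _ xP) D// subrK (coding_zero _ xP').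
rewrite mE Px// (_ : P t + _ - _ + _ = P' (b + d%:Z) + i%:Z).
  by rewrite Px'// -yy'// -tE.
by have := D d (ltnW lt); rewrite -tE; lia.
Qed.

Lemma coding_shift x P y :
  coding x P y -> coding (fun n => x (n + 1)) (fun t => P t - 1) y.
Proof.
move=> [PS Px]; split=> [t|t i ti]; first by rewrite PS addrAC.
by rewrite addrAC subrK Px.
Qed.

Lemma coding_reindex x P y (a : int) :
  coding x P y -> coding x (fun t => P (a + t)) (fun t => y (a + t)).
Proof.
by move=> [PS Px]; split=> [t|t i ti]; [rewrite addrA PS|exact: Px].
Qed.

Lemma coding_exists (y : int -> nat) : exists x P, coding x P y /\ P 0 = 0.
Proof.
pose P (t : int) : int := match t with
  | Posz n => (\sum_(i < n) (y i%:Z).+1)%N%:Z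
  | Negz n => - (\sum_(i < n.+1) (y (- i.+1%:Z)).+1)%N%:Z end.
have PS (t : int) : P (t + 1) = P t + (y t).+1%:Z.
  case: t => [n|[|n]].
  - by rewrite -PoszD addn1 /P big_ord_recr PoszD.
  - rewrite (_ : Negz 0 + 1 = Posz 0)// /P big_ord0 big_ord1.
    by rewrite (_ : Negz 0 = - 1%:Z)// addNr.
  - have -> : Negz n.+1 + 1 = Negz n by lia.
    rewrite /P [in RHS]big_ord_recr/= PoszD opprD.
    by rewrite (_ : Negz n.+1 = - n.+2%:Z)// subrK.
have P0 : P 0 = 0 by rewrite -[0]/(Posz 0) /P big_ord0.
pose x (m : int) := asbool (forall t, m <> P t).
exists x, P; split => //; split => // t i ti; rewrite /x.
case: i ti => [|i] ti /=.
  by rewrite addr0; apply/asboolPn => /(_ t).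
apply/asboolP => t' E.
have M (u : int) (n : nat) : P u + n%:Z <= P (u + n%:Z).
  elim: n => [|n IH]; first by rewrite !addr0.
  have -> : u + n.+1%:Z = u + n%:Z + 1 by lia.
  by have := PS (u + n%:Z); lia.
have [le|lt] := leP t' t.
  have [d tE] : exists d : nat, t = t' + d%:Z by exists `|(t - t')%R|%N; lia.
  by have := M t' d; rewrite -tE; lia.
have [d tE] : exists d : nat, t' = t + 1 + d%:Z.
  by exists `|(t' - (t + 1))%R|%N; lia.
by have := M (t + 1) d; rewrite -tE PS; lia.
Qed.

Lemma coding_bounded_gaps (x : int -> bool) (M : nat) :
  (forall m : int, exists2 i : nat, (i <= M)%N & x (m + i%:Z) = false) ->
  exists P y, coding x P y.
Proof.
move=> gap.
have nxt (m : int) : exists i : nat, ~~ x (m + 1 + i%:Z).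
  by have [i _ /negbT xi] := gap (m + 1); exists i.
have prv (m : int) : exists i : nat, ~~ x (m - 1 - i%:Z).
  have [i iM /negbT xi] := gap (m - 1 - M%:Z); exists (M - i)%N.
  by rewrite (_ : _ - _ = m - 1 - M%:Z + i%:Z)//; lia.
pose nx (m : int) := m + 1 + (ex_minn (nxt m))%:Z.
pose pv (m : int) := m - 1 - (ex_minn (prv m))%:Z.
have nx0 (m : int) : x (nx m) = false by rewrite /nx; case: ex_minnP => i /negbTE.
have pv0 (m : int) : x (pv m) = false by rewrite /pv; case: ex_minnP => i /negbTE.
have nx_gt (m : int) : m < nx m by rewrite /nx; lia.
have nx1 (m p : int) : m < p < nx m -> x p.
  rewrite /nx; case: ex_minnP => i _ im mp; have := im `|(p - (m + 1))%R|%N.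
  rewrite (_ : m + 1 + _ = p); last by lia.
  by case: (x p) => // /(_ isT); lia.
(* This makes the recursion [P (t + 1) = nx (P t)] valid on the negative side too, where [P] is
   defined by going backwards. *)
have pvK (m : int) : x m = false -> nx (pv m) = m.
  move=> xm; have [lt|lt|//] := ltgtP (nx (pv m)) m.
    have H := nx_gt (pv m); have N0 := nx0 (pv m); set p := nx _ in lt H N0.
    move: H; rewrite /pv; case: ex_minnP => i _ im H.
    have := im `|(m - 1 - p)%R|%N; rewrite (_ : m - 1 - _ = p); last by lia.
    by rewrite N0 => /(_ isT); lia.
  have := nx1 (pv m) m; rewrite xm lt andbT => H.
  by suff : false by []; apply: H; rewrite /pv; lia.
pose a := nx 0.
pose P (t : int) := match t with Posz n => iter n nx a | Negz n => iter n.+1 pv a end.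
have P0 (t : int) : x (P t) = false.
  by case: t => [[|n]|n]; [exact: nx0| |]; rewrite /P iterS.
have PS (t : int) : P (t + 1) = nx (P t).
  case: t => [n|[|n]]; first by rewrite -PoszD addn1.
    by rewrite /P /= pvK// nx0.
  have -> : Negz n.+1 + 1 = Negz n by lia.
  by rewrite /P [in RHS]iterS pvK//; exact: (P0 (Negz n)).
have PS1 (t : int) : P t < P (t + 1) by rewrite PS nx_gt.
exists P, (fun t => `|(P (t + 1) - P t)%R|%N.-1); split => [t|t i ti].
  by move: (PS1 t); move: (P t) (P (t + 1)) => p q; lia.
case: i ti => [|i] ti; first by rewrite addr0 P0.
apply: (nx1 (P t)); rewrite -PS; move: ti (PS1 t).
by move: (P t) (P (t + 1)) => p q; lia.
Qed.

(* [frame x i y]: the last zero of [x] at or before the origin is at [-i], and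
   [y] lists the runs of ones starting from the run after that zero. *)
Definition frame (x : int -> bool) (i : nat) (y : int -> nat) : Prop :=
  (i <= y 0%R)%N /\ exists2 P, coding x P y & P 0 = - i%:Z.

Lemma coding_frame x P y : coding x P y ->
  exists i a, frame x i (fun t => y (a + t)).
Proof.
move=> xP; have [a [i ia aE]] := coding_cover 0 xP; exists i, a.
split; first by rewrite addr0.
by exists (fun t => P (a + t)); [exact: coding_reindex|rewrite addr0; lia].
Qed.

(** A zero with its run takes at most M places, so radius M(K+1) contains K full letters on either
    side of the current run, the offset i < M included. *)
Lemma frame_window x i y x' i' y' (M K L : nat) :
  frame x i y -> frame x' i' y' -> (forall t, (y t < M)%N) ->
  (M * K.+1 <= L)%N ->
  (forall m : int, (`|m| <= L)%N -> x m = x' m) ->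
  i = i' /\ forall t : int, (`|t| <= K)%N -> y t = y' t.
Proof.
move=> [iy [P xP P0]] [iy' [P' xP' P0']] yM KL xx'.
have [PS Px] := xP; have [PS' Px'] := xP'.
have up (t : int) (n : nat) : P (t + n%:Z) <= P t + (M * n)%N%:Z.
  elim: n => [|n IH]; first by rewrite muln0 !addr0.
  by rewrite (coding_next _ _ xP); have := yM (t + n%:Z); nia.
have lo : P 0 <= P (- K%:Z) + (M * K)%N%:Z.
  by have := up (- K%:Z) K; rewrite (_ : - K%:Z + K%:Z = 0); last by lia.
have hi : P K.+1%:Z <= P 0 + (M * K.+1)%N%:Z.
  by have := up 0 K.+1; rewrite (_ : 0 + K.+1%:Z = K.+1%:Z); last by lia.
have L1 : P (- K%:Z) + (0 - - K%:Z) <= P 0 by apply: coding_le xP _; lia.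
have L2 : P 0 + (K.+1%:Z - 0) <= P K.+1%:Z by apply: coding_le xP _; lia.
have i_lt := yM 0; rewrite mulnS in KL hi.
have [b bE] : exists b, P (- K%:Z) = P' b.
  by apply: (coding_zeroP xP'); rewrite -xx' ?(coding_zero _ xP)//; lia.
have sync := @coding_sync x P y x' P' y' (- K%:Z) b 0 (2 * K).+1 xP xP'.
have {sync} sync : forall j : nat, (j <= (2 * K).+1)%N ->
    P' (b + j%:Z) = P (- K%:Z + j%:Z) /\
    forall l : nat, (l < j)%N -> y (- K%:Z + l%:Z) = y' (b + l%:Z).
  move=> j jK; have [||//] := sync _ _ j jK; rewrite ?addr0//.
  move=> m; rewrite (_ : - K%:Z + _ = K.+1%:Z); last by lia.
  by move=> mK; rewrite addr0 xx'//; lia.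
have [S0 _] := sync K ltac:(lia); rewrite addNr in S0.
have [S1 _] := sync K.+1 ltac:(lia).
(* [coding_sync] aligns the zeros only up to an unknown index b; it is identified because in both
   codings the origin lies in the run of index 0. *)
have bK : b + K%:Z = 0.
  apply: (@coding_interval x' P' y' _ _ 0 xP').
    rewrite -addrA (_ : K%:Z + 1 = K.+1%:Z); last by lia.
    rewrite S0 S1 (_ : - K%:Z + K.+1%:Z = 0 + 1) ?PS; last by lia.
    by rewrite P0; move: iy; move: (y 0) => u; lia.
  by rewrite PS' P0'; move: iy'; move: (y' 0) => u; lia.
split; first by move: S0; rewrite bK P0 P0'; lia.
move=> t tK; have [_ /(_ `|(t + K%:Z)%R|%N)] := sync _ (leqnn _).
rewrite gez0_abs; last by lia.
rewrite (_ : - K%:Z + _ = t); last by lia.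
by rewrite (_ : b + _ = t) => [->//|]; lia.
Qed.

(** Each letter takes at least one place, so K letters on either side of the current run determine
    radius K. *)
Lemma frame_grow x i y x' y' (K : nat) :
  frame x i y -> frame x' i y' ->
  (forall t : int, (`|t| <= K)%N -> y t = y' t) ->
  forall m : int, (`|m| <= K)%N -> x m = x' m.
Proof.
move=> [iy [P xP P0]] [iy' [P' xP' P0']] yy' m mK.
have D : P' (- K%:Z) = P (- K%:Z).
  suff H (n : nat) : (n <= K)%N -> P' (- n%:Z) = P (- n%:Z) by exact: H.
  elim: n => [|n IH] nK; first by rewrite oppr0 P0 P0'.
  have [PS _] := xP; have [PS' _] := xP'.
  have := PS (- n.+1%:Z); have := PS' (- n.+1%:Z).
  rewrite (_ : - n.+1%:Z + 1 = - n%:Z); last by lia.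
  by rewrite IH ?yy'; lia.
have [PS _] := xP.
rewrite (@coding_transfer x P y x' P' y' (- K%:Z) (- K%:Z) (2 * K).+1 xP xP').
- by rewrite D subrK.
- by move=> i0 i0K; apply: yy'; lia.
- have L1 : P (- K%:Z) + (0 - - K%:Z) <= P 0 by apply: coding_le xP _; lia.
  have L2 : P (0 + 1) + (K%:Z + 1 - (0 + 1)) <= P (K%:Z + 1).
    by apply: coding_le xP _; lia.
  rewrite (_ : - K%:Z + _ = K%:Z + 1); last by lia.
  rewrite (PS 0) P0 in L2; rewrite P0 in L1; move: (y 0) iy L2 => u iu L2.
  by move: (P (- K%:Z)) (P (K%:Z + 1)) L1 L2 => p q; lia.
Qed.

Lemma frame_shift x i y : frame x i y -> (i < y 0%R)%N ->
  frame (fun n => x (n + 1)) i.+1 y.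
Proof.
move=> [_ [P xP P0]] iy; split => //; exists (fun t => P t - 1).
  exact: coding_shift.
by rewrite P0; lia.
Qed.

Lemma frame_carry x y : frame x (y 0) y ->
  frame (fun n => x (n + 1)) 0 (fun t => y (t + 1)).
Proof.
move=> [_ [P xP P0]]; split => //; exists (fun t => P (1 + t) - 1).
  have := coding_reindex 1 (coding_shift xP).
  rewrite (_ : (fun t => y (1 + t)) = fun t => y (t + 1))//.
  by apply: funext => t; rewrite addrC.
by case: xP => PS _; have := PS 0; rewrite P0 add0r addr0 => ->; lia.
Qed.

Lemma frame_exists (i : nat) (y : int -> nat) : (i <= y 0%R)%N ->
  exists x, frame x i y.
Proof.
move=> iy; have [x [P [xP P0]]] := coding_exists y.
exists (fun n => x (n + i%:Z)); split => //; exists (fun t => P t - i%:Z).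
  case: xP => PS Px; split=> [t|t j tj]; first by rewrite PS addrAC.
  by rewrite addrAC subrK Px.
by rewrite P0 sub0r.
Qed.

(** * The language of the rank-one word, read through codings *)

Section RankOneWord.
Variable k : nat.
Local Notation r := k.+3.

Definition ruler_word : int -> bool :=
  projT1 (cid (coding_exists (fun t => ruler k (1 + t)))).

Lemma ruler_word_coding : exists2 P,
  coding ruler_word P (fun t => ruler k (1 + t)) & P 0 = 0.
Proof. by rewrite /ruler_word; case: cid => x [P []] /=; exists P. Qed.

Lemma ruler_word_language x P y : coding x P y -> toeplitz k y ->
  forall (m : int) (L : nat), exists n : nat, forall i : nat, (i < L)%N ->
    x (m + i%:Z) = ruler_word (n%:Z + i%:Z).
Proof.
move=> xP Ty m L; have [P' xP' P'0] := ruler_word_coding.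
pose K := (`|m| + `|P 0%R| + L)%N; have [c cK yc] := Ty K.
have L1 : P (- K%:Z) + (0 - - K%:Z) <= P 0 by apply: coding_le xP _; lia.
have L2 : P 0 + (K%:Z - 0) <= P K%:Z by apply: coding_le xP _; lia.
have L3 : P' 0 + (c - 1 - K%:Z - 0) <= P' (c - 1 - K%:Z).
  by apply: coding_le xP' _; lia.
exists `|(m - P (- K%:Z) + P' (c - 1 - K%:Z))%R|%N => i iL.
rewrite (@coding_transfer x P y ruler_word P' (fun t => ruler k (1 + t))
  (- K%:Z) (c - 1 - K%:Z) (2 * K) xP xP').
- by congr ruler_word; lia.
- by move=> j jK; rewrite yc; [congr ruler|]; lia.
- by rewrite (_ : - K%:Z + _ = K%:Z); lia.
Qed.

Lemma ruler_word_language_coding (x : int -> bool) :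
  (forall (m : int) (L : nat), exists n : nat, forall i : nat, (i < L)%N ->
    x (m + i%:Z) = ruler_word (n%:Z + i%:Z)) ->
  exists P y, coding x P y /\ toeplitz k y.
Proof.
move=> xL; have [P' xP' P'0] := ruler_word_coding; have [PS' Px'] := xP'.
have [P [y xP]] : exists P y, coding x P y.
  apply: (@coding_bounded_gaps x k.+3) => m.
  have [n xn] := xL m k.+4; have [t [i ti nE]] := coding_cover n xP'.
  have tk := ruler_lt k (1 + t).
  exists (ruler k (1 + t) - i).+1; first by lia.
  rewrite xn; last by lia.
  by rewrite -(coding_zero (t + 1) xP') PS'; congr ruler_word; lia.
exists P, y; split => // K.
have L1 : P (- K%:Z) + (K%:Z + 1 - - K%:Z) <= P (K%:Z + 1).
  by apply: coding_le xP _; lia.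
have [n xn] := xL (P (- K%:Z)) `|(P (K%:Z + 1) - P (- K%:Z))%R|%N.+1.
have [b bE] : exists b, n%:Z = P' b.
  apply: (coding_zeroP xP'); have := xn 0%N isT; rewrite !addr0 => <-.
  exact: coding_zero xP.
(* The occurrence lies in the one-sided word, which gives the strictly positive arguments that
   [toeplitz] demands. *)
have b0 : 0 <= b.
  have [//|lt] := leP 0 b.
  by have : P' b + (0 - b) <= P' 0 by [apply: coding_le xP' _; lia]; lia.
exists (b + 1 + K%:Z) => [|t tK]; first by lia.
have [|m|_ H] := @coding_sync x P y _ P' _ (- K%:Z) b (n%:Z - P (- K%:Z))
  (2 * K).+1 xP xP' _ _ (2 * K).+1 (leqnn _).
- by rewrite subrKC.
- rewrite (_ : - K%:Z + _ = K%:Z + 1); last by lia.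
  move=> mK; have := xn `|(m - P (- K%:Z))%R|%N.
  rewrite gez0_abs ?subrKC; last by lia.
  by move=> ->; [congr ruler_word|]; lia.
- have := H `|(t + K%:Z)%R|%N; rewrite gez0_abs; last by lia.
  rewrite (_ : - K%:Z + _ = t); last by lia.
  by move=> ->; [congr ruler|]; lia.
Qed.

Lemma ruler_word_recurrent x P y : coding x P y -> toeplitz k y ->
  forall L : nat, exists a : int, forall i : nat, (i < L)%N ->
    x (a + i%:Z) = ruler_word i%:Z.
Proof.
move=> xP Ty L; have [P' xP' P'0] := ruler_word_coding.
have [a ya] := toeplitz_prefix L.+1 Ty; have rL := ltn_expl L.+1 (isT : (1 < r)%N).
(* [toeplitz_prefix] controls the letters from t = 1 on, and the first run of [ruler_word] is
   [ruler 1]. *)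
exists (P (a + 1)) => i iL.
rewrite (@coding_transfer ruler_word P' _ x P y 0 (a + 1) L xP' xP).
- by rewrite P'0; congr x; lia.
- by move=> j jL; rewrite add0r -PoszD -addrA -PoszD ya//; lia.
- have : P' 0 + (0 + L%:Z - 0) <= P' (0 + L%:Z) by apply: coding_le xP' _; lia.
  by rewrite P'0; move: (P' (0 + L%:Z)) => p; lia.
Qed.

End RankOneWord.

(** * Unbounded letter sums *)

Section Sums.
Variable k : nat.
Local Notation r := k.+3.

Lemma linear_growth_bounded (a C : rat) :
  (forall n : nat, `|n%:R * a| <= C) -> a = 0.
Proof.
move=> H; apply/eqP/negPn/negP => a0.
have a_gt0 : 0 < `|a| by rewrite normr_gt0.
have C0 : 0 <= C / `|a|.
  by apply: divr_ge0 (ltW a_gt0); apply: le_trans (H 0%N).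
have := H (Num.bound (C / `|a|)); rewrite normrM normr_nat leNgt => /negP; apply.
by rewrite -ltr_pdivrMr// archi_boundP.
Qed.

(* With B n the sum of [m] along the first n letters, B (r q) = B q + q S, where
   S is the sum of all [m j], and B (r q + u) = B (r q) + m 0 + ... + m (u-1).
   Boundedness forces S = 0, and then the partial sums to vanish, along
   n_0 = 0, n_(l+1) = r n_l + u. *)
Lemma ruler_sums_bounded (m : nat -> rat) (C : rat) :
  (forall n : nat, `|\sum_(u < n) m (ruler k u.+1%:Z)| <= C) ->
  forall j : nat, (j < k.+2)%N -> m j = 0.
Proof.
pose B n := \sum_(u < n) m (ruler k u.+1%:Z); rewrite -/B => BC.
have BD (q u : nat) : (u < r)%N -> B (r * q + u)%N = B (r * q)%N + \sum_(j < u) m j.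
  move=> ur; rewrite /B big_split_ord/=; congr (_ + _).
  apply: eq_bigr => j _; congr m; rewrite -addnS PoszD PoszM rulerD//.
  by case: j => j /= ju; lia.
pose S := \sum_(j < k.+2) m j.
have BM (q : nat) : B (r * q)%N = B q + q%:R * S.
  elim: q => [|q IH]; first by rewrite muln0 mul0r addr0.
  have -> : (r * q.+1 = (r * q + k.+2).+1)%N by lia.
  rewrite {1}/B big_ord_recr/= -/(B _) BD// IH -/S {2}/B big_ord_recr/= -/(B q).
  rewrite (_ : (r * q + k.+2).+1%:Z = r%:Z * q.+1%:Z); last by lia.
  by rewrite rulerM -[q.+1]addn1 natrD; ring.
have S0 : S = 0.
  apply: (@linear_growth_bounded _ (C + C)) => q.
  have -> : q%:R * S = B (r * q)%N - B q by rewrite BM; ring.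
  by apply: le_trans (ler_normB _ _) _; apply: lerD; exact: BC.
have D0 (u : nat) : (u < r)%N -> \sum_(j < u) m j = 0.
  move=> ur; apply: (@linear_growth_bounded _ C) => l.
  have [n <-] : exists n, B n = l%:R * \sum_(j < u) m j; last exact: BC.
  elim: l => [|l [n nE]]; first by exists 0%N; rewrite /B big_ord0 mul0r.
  exists (r * n + u)%N; rewrite BD// BM S0 mulr0 addr0 nE -[l.+1]addn1 natrD.
  by ring.
move=> j jk; have := D0 j.+1 jk; rewrite big_ord_recr/= D0 ?add0r//.
exact: ltnW.
Qed.

(** Here g is nonzero only at a zero of the word, where it reads off the weight of the run that
    follows. Its Birkhoff sum over one run is thus a single weight, and sums over time become sums
    over letters. *)
Lemma frame_sums (g : (int -> bool) -> rat) (m : nat -> rat) :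
  (forall x i y, frame x i y -> toeplitz k y ->
     g x = if i == 0%N then m (y 0) else 0) ->
  forall x y, frame x 0 y -> toeplitz k y ->
  forall q : nat, exists n : nat,
    \sum_(t < n) g (iter t (fun (z : int -> bool) (j : int) => z (j + 1)) x) =
    \sum_(u < q) m (y u%:Z).
Proof.
move=> gm x y xy Ty q; pose T (z : int -> bool) (j : int) := z (j + 1).
rewrite -/T.
have block (z : int -> bool) (w : int -> nat) : frame z 0 w -> toeplitz k w ->
    frame (iter (w 0).+1 T z) 0 (fun t => w (t + 1)) /\
    \sum_(t < (w 0).+1) g (iter t T z) = m (w 0).
  move=> zw Tw.
  have fr (t : nat) : (t <= w 0)%N -> frame (iter t T z) t w.
    elim: t => [//|t IH] tw; rewrite iterS; apply: frame_shift (IH (ltnW tw)) tw.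
  split; first by rewrite iterS; apply: frame_carry; exact: fr.
  rewrite big_ord_recl/= (gm _ _ _ zw Tw)/= big1 ?addr0// => t _.
  by rewrite (gm _ _ _ (fr t.+1 _) Tw)//= ltn_ord.
suff [n [_ nE]] : exists n : nat, frame (iter n T x) 0 (fun t => y (q%:Z + t)) /\
    \sum_(t < n) g (iter t T x) = \sum_(u < q) m (y u%:Z) by exists n.
elim: q => [|q [n [nq nE]]].
  exists 0%N; rewrite !big_ord0; split => //.
  by rewrite (_ : (fun t => y (0%:Z + t)) = y)//; apply: funext => t; rewrite add0r.
have [F E] := block _ _ nq (toeplitz_shift q%:Z Ty).
exists (n + (y (q%:Z + 0)%R).+1)%N; split.
  rewrite addnC iterD.
  rewrite (_ : (fun t => y (q.+1%:Z + t)) = (fun t => y (q%:Z + (t + 1))))//.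
  by apply: funext => t; congr y; lia.
rewrite big_split_ord/= nE [in RHS]big_ord_recr/=; congr (_ + _).
rewrite -[in RHS](addr0 q%:Z) -E; apply: eq_bigr => t _.
by rewrite addnC iterD.
Qed.

End Sums.

(** * Topologies generated by cylinders *)

(** A decreasing sequence of equivalence relations generating the topology, that is, an ultrametric
    structure. It is shared by X_V (central windows) and by path spaces (common prefixes), and it
    reduces continuity to a comparison of indices. *)
Record cylinder_basis (T : topologicalType) (E : nat -> T -> T -> Prop) := {
  cyl_refl : forall n x, E n x x;
  cyl_sym : forall n x y, E n x y -> E n y x;
  cyl_trans : forall n x y z, E n x y -> E n y z -> E n x z;
  cyl_mono : forall m n x y, (m <= n)%N -> E n x y -> E m x y;
  cyl_sep : forall x y, (forall n, E n x y) -> x = y;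
  cyl_nbhs : forall x (A : set T), nbhs x A <-> exists n, E n x `<=` A }.

Section DiscreteProduct.
Variables (I : eqType) (K : I -> topologicalType).
Hypothesis Kd : forall i (a : K i), nbhs a [set a].

Lemma nbhs_cylinder (x : prod_topology K) (s : seq I) :
  nbhs x [set y : prod_topology K | forall i, i \in s -> x i = y i].
Proof.
elim: s => [|j s IH].
  by apply: filterS filterT => y _ i; rewrite in_nil.
have jx : nbhs x [set y : prod_topology K | x j = y j].
  apply: (@filterS _ (nbhs x) _ ((@proj I K j) @^-1` [set x j])).
    by move=> y /= <-.
  exact: (@proj_continuous I K j x _ (Kd (x j))).
apply: filterS (filterI jx IH) => y [/= xy xys] i; rewrite inE.
by move=> /predU1P[->//|/xys].
Qed.

(** The product topology is a supremum of initial topologies, so the filter of sets containing a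
    finite cylinder around x converges to x as soon as it does in each coordinate. *)
Lemma nbhs_sub_cylinder (x : prod_topology K) (A : set (prod_topology K)) :
  nbhs x A -> exists s : seq I, forall y, (forall i, i \in s -> x i = y i) -> A y.
Proof.
pose F : set_system (prod_topology K) := [set A | exists s : seq I,
  [set y | forall i, i \in s -> x i = y i] `<=` A].
have FF : Filter F.
  split=> [|P Q [s sP] [s' sQ]|P Q PQ [s sP]].
  - by exists [::].
  - exists (s ++ s') => y xy.
    by split; [apply: sP|apply: sQ] => i is_; apply: xy; rewrite mem_cat is_ ?orbT.
  - by exists s; apply: subset_trans PQ.
suff Fx : F --> x by move=> /Fx.
apply/cvg_sup => i B [_ [[W oW <-] /= Wx WB]]; exists [:: i] => y xy; apply: WB.
by rewrite /= -xy// inE.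
Qed.

Lemma nbhs_set_type (X : topologicalType) (A : set X) (x : A) (U : set A) :
  nbhs x U <-> exists2 W : set X, nbhs (set_val x) W & set_val @^-1` W `<=` U.
Proof.
split=> [[_ [[W oW <-] Wx WU]]|[W Wx WU]].
  by exists W => //; exact: open_nbhs_nbhs.
by apply: filterS WU _; exact: (@initial_continuous A X set_val).
Qed.

Lemma prod_cylinder_basis (dom : nat -> seq I) (A : set (prod_topology K)) :
  (forall m n, (m <= n)%N -> {subset dom m <= dom n}) ->
  (forall i, exists n, i \in dom n) ->
  @cylinder_basis A
    (fun n x y => forall i, i \in dom n -> set_val x i = set_val y i).
Proof.
move=> domS domT; split=> [//|n x y xy i /xy//|n x y z xy yz i i_n|||].
- by rewrite xy// yz.
- by move=> m n x y mn xy i im; apply: xy; exact: domS im.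
- move=> x y xy; apply: val_inj; apply: functional_extensionality_dep => i.
  by have [n i_n] := domT i; apply: (xy n).
move=> x U; rewrite nbhs_set_type; split=> [[W Wx WU]|[n xU]].
  have [s sW] := nbhs_sub_cylinder Wx.
  have [n sn] : exists n, {subset s <= dom n}.
    elim: s {sW} => [|i s [n sn]]; first by exists 0%N.
    have [m im] := domT i; exists (maxn m n) => j; rewrite inE => /predU1P[->|js].
      by apply: domS im; exact: leq_maxl.
    by apply: domS (sn _ js); exact: leq_maxr.
  by exists n => y xy; apply: WU; apply: sW => i /sn; exact: xy.
exists [set y : prod_topology K | forall i, i \in dom n -> set_val x i = y i].
  exact: nbhs_cylinder.
by move=> y /= xy; apply: xU.
Qed.

End DiscreteProduct.

Lemma compact_set_type (X : topologicalType) (A : set X) :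
  compact A -> compact [set: A].
Proof.
move=> cA F PF _.
have [|a [Aa aF]] := cA (set_val @ F) (fmap_proper_filter _ PF).
  by apply: (@filterS _ F _ setT); [move=> x _; exact: set_valP|exact: filterT].
exists (exist _ a (mem_set Aa)); split => // B U FB /nbhs_set_type[W Wa WU].
have FB' : (set_val @ F) (set_val @` B).
  by apply: (@filterS _ F _ B) => // b Bb; exists b.
have [_ [[b Bb <-] Wb]] := aF _ _ FB' Wa.
by exists b; split => //; apply: WU.
Qed.

(** If no [G n] were everything, their complements would generate a proper filter; a cluster point x
    of it contradicts [nbhs x (G n)]. *)
Lemma compact_uniform (T : topologicalType) (G : nat -> set T) :
  compact [set: T] -> (forall m n, (m <= n)%N -> G m `<=` G n) ->
  (forall x : T, exists n, nbhs x (G n)) -> exists n, forall x, G n x.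
Proof.
move=> cT Gmono Gnear; apply: contrapT => /forallNP noG.
pose F : set_system T := [set A | exists n, ~` G n `<=` A].
have PF : ProperFilter F.
  split.
    by move=> [n H]; apply: (noG n) => x; apply: contrapT; exact: H.
  split=> [|P Q [m mP] [n nQ]|P Q PQ [n nP]].
  - by exists 0%N.
  - exists (maxn m n) => x nx; split; [apply: mP|apply: nQ] => Gx; apply: nx.
      by apply: Gmono Gx; exact: leq_maxl.
    by apply: Gmono Gx; exact: leq_maxr.
  - by exists n; apply: subset_trans PQ.
have [x [_ Fx]] := cT F PF filterT; have [n Gn] := Gnear x.
have [y [//]] : (~` G n `&` G n) !=set0 by apply: Fx => //; exists n.
Qed.

Section CylinderBasis.
Variables (T : topologicalType) (E : nat -> T -> T -> Prop).
Hypothesis ET : cylinder_basis E.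

Lemma cyl_nbhs_cylinder n x : nbhs x (E n x).
Proof. by apply/(cyl_nbhs ET); exists n. Qed.

Lemma cyl_separate x y : x <> y -> exists n, ~ E n x y.
Proof.
move=> xy; apply: contrapT => /forallNP H; apply: xy.
by apply: (cyl_sep ET) => n; exact: contrapT.
Qed.

Lemma cylinder_clopen n x : clopen (E n x).
Proof.
split.
  rewrite openE => y xy; apply/(cyl_nbhs ET); exists n => z; exact: (cyl_trans ET) xy.
move=> y /(_ _ (cyl_nbhs_cylinder n y))[z [xz yz]].
exact: (cyl_trans ET) xz (cyl_sym ET yz).
Qed.

Lemma cylinder_hausdorff : hausdorff_space T.
Proof.
move=> x y xy; apply: (cyl_sep ET) => n.
have [z [xz yz]] := xy _ _ (cyl_nbhs_cylinder n x) (cyl_nbhs_cylinder n y).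
exact: (cyl_trans ET) xz (cyl_sym ET yz).
Qed.

Lemma cylinder_zero_dimensional : zero_dimensional T.
Proof.
move=> x y /eqP /cyl_separate[n xy]; exists (E n x); split => //.
  exact: cylinder_clopen.
exact: cyl_refl.
Qed.

Lemma cylinder_metrizable : metrizable T.
Proof.
pose R : realType := Rdefinitions.R.
have sepn x y : x <> y -> exists n, `[< ~ E n x y >].
  by move=> /cyl_separate[n xy]; exists n; apply/asboolP.
(* The ultrametric 1/(n+1), with n the first index separating x from y, so that [E n] is exactly the
   relation of distance below 1/(n+1). *)
pose dist x y : R := if pselect (x = y) is right xy then (ex_minn (sepn x y xy)).+1%:R^-1 else 0.
have distE x y n : E n x y <-> dist x y < n.+1%:R^-1.
  rewrite /dist; case: pselect => [->|xy].
    by split=> _; [rewrite invr_gt0 ltr0n|exact: cyl_refl].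
  case: ex_minnP => m /asboolP mxy mmin.
  rewrite ltf_pV2 ?posrE ?ltr0n// ltr_nat ltnS; split=> [nxy|nm].
    by rewrite ltnNge; apply/negP => mn; apply: mxy; exact: (cyl_mono ET) mn nxy.
  apply: contrapT => /asboolP /mmin; lia.
have dist_ge0 x y : 0 <= dist x y.
  by rewrite /dist; case: pselect => [//|xy]; rewrite invr_ge0 ler0n.
exists R, dist; split.
- move=> x y; split=> [|->]; last by rewrite /dist; case: pselect.
  by rewrite /dist; case: pselect => // xy /eqP; rewrite invr_eq0 pnatr_eq0.
- move=> x y; apply/eqP; rewrite eq_le; apply/andP.
  have sym a b : dist a b <= dist b a.
    rewrite {1}/dist; case: pselect => // ab; case: ex_minnP => m /asboolP mab _.
    rewrite leNgt; apply/negP => /distE ba; apply: mab; exact: cyl_sym.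
  by split; exact: sym.
- move=> x y z; rewrite {1}/dist; case: pselect => [_|xz]; first exact: addr_ge0.
  case: ex_minnP => m /asboolP mxz _; rewrite leNgt; apply/negP => lt; apply: mxz.
  apply: (@cyl_trans _ _ ET _ _ y); apply/distE; apply: le_lt_trans lt.
    by rewrite lerDl.
  by rewrite lerDr.
- move=> x A; rewrite (cyl_nbhs ET); split=> [[n nA]|[e e0 eA]].
    by exists n.+1%:R^-1 => [|y /= /distE /nA//]; rewrite invr_gt0 ltr0n.
  exists (Num.bound e^-1) => y /distE xy; apply: eA => /=.
  apply: lt_trans xy _; rewrite -[ltRHS]invrK ltf_pV2 ?posrE ?invr_gt0 ?ltr0n//.
  apply: lt_trans (archi_boundP _) _; first by rewrite invr_ge0 ltW.
  by rewrite ltr_nat.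
Qed.

End CylinderBasis.

Section CylinderMaps.
Variables (T T' : topologicalType) (E : nat -> T -> T -> Prop).
Variables (E' : nat -> T' -> T' -> Prop).
Hypotheses (ET : cylinder_basis E) (ET' : cylinder_basis E').

Lemma cylinder_continuous (f : T -> T') :
  (forall x n, exists m, forall y, E m x y -> E' n (f x) (f y)) <-> continuous f.
Proof.
split=> [H x A /(cyl_nbhs ET')[n nA]|cf x n].
  by apply/(cyl_nbhs ET); have [m xm] := H x n; exists m => y /xm /nA.
by have /(cyl_nbhs ET) := cf x _ (cyl_nbhs_cylinder ET' n (f x)).
Qed.

(** Uniform separation gives injectivity and a continuous inverse. By compactness, a point outside
    the image would stay separated from it at one fixed index, against density. *)
Lemma cylinder_homeomorphism (f : T -> T') : compact [set: T] -> continuous f ->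
  (forall n, exists m, forall x y, E' m (f x) (f y) -> E n x y) ->
  (forall y n, exists x, E' n (f x) y) -> homeomorphism f.
Proof.
move=> cT cf finj fdense.
have fsurj y : exists x, f x = y.
  apply: contrapT => /forallNP fy.
  have [|x|n nG] := @compact_uniform T (fun n => [set x | ~ E' n (f x) y]) cT.
  - by move=> m n mn x /= H H'; apply: H; exact: (cyl_mono ET') mn H'.
  - have [n fxy] := cyl_separate ET' (fy x); exists n.
    apply: (@filterS _ (nbhs x) _ (f @^-1` (E' n (f x)))).
      by move=> z /= xz zy; apply: fxy; exact: (cyl_trans ET') xz zy.
    exact: cf (cyl_nbhs_cylinder ET' n (f x)).
  - by have [x xy] := fdense y n; exact: (nG x).
have [g gK] := choice fsurj.
have fK : cancel f g.
  move=> x; apply: (cyl_sep ET) => n; have [m mE] := finj n; apply: mE.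
  by rewrite gK; exact: cyl_refl.
split=> //; exists g; split => //.
move=> y A /(cyl_nbhs ET)[n nA]; apply/(cyl_nbhs ET').
have [m mE] := finj n; exists m => z yz; apply/nA/mE.
by rewrite !gK.
Qed.

End CylinderMaps.

(** * A lower bound for the topological rank *)

Section Paths.
Variable B : ordered_bratteli.
Implicit Types p q : path_set B.

Definition agree_below (n : nat) p q : Prop :=
  forall i, (i < n)%N -> path_edge p i = path_edge q i.

Lemma path_cylinder_basis : cylinder_basis agree_below.
Proof.
have := @prod_cylinder_basis nat (fun n => discrete_topology (edge B n))
  (fun i => @discrete_set1 _) (iota 0) (path_set B).
have -> : (fun (n : nat) p q => forall i, i \in iota 0 n -> set_val p i = set_val q i)
    = agree_below.
  apply: funext => n; apply: funext => p; apply: funext => q; apply: propext.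
  by split=> H i; [move=> i_n; apply: H|move=> i_n; apply: H]; move: i_n; rewrite mem_iota.
apply=> [m n mn i|i]; first by rewrite !mem_iota /=; lia.
by exists i.+1; rewrite mem_iota/=.
Qed.

Lemma path_edge_src p n : rng (path_edge p n) = src (path_edge p n.+1).
Proof. exact: (set_valP p). Qed.

Lemma edge_min_uniq n (e e' : edge B n) :
  edge_min e -> edge_min e' -> rng e = rng e' -> e = e'.
Proof.
move=> em em' /ele_comparable/orP[/em' //|/em //].
Qed.

Lemma edge_succ_uniq n (e f f' : edge B n) :
  edge_succ e f -> edge_succ e f' -> f = f'.
Proof.
move=> [ef nef fs] [ef' nef' fs'].
have /ele_comparable/orP[ff'|f'f] : rng f = rng f'.
  have /ele_comparable <- : ele e f || ele f e by rewrite ef.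
  by apply/ele_comparable; rewrite ef'.
- by have [/esym//|//] := fs' f ef ff'.
- by have [/esym//|/esym//] := fs f' ef' f'f.
Qed.

Definition max_prefix (n : nat) p : Prop :=
  forall i, (i < n)%N -> edge_max (path_edge p i).
Definition min_prefix (n : nat) p : Prop :=
  forall i, (i < n)%N -> edge_min (path_edge p i).

Lemma min_prefix_uniq n p q : min_prefix n.+1 p -> min_prefix n.+1 q ->
  rng (path_edge p n) = rng (path_edge q n) -> agree_below n.+1 p q.
Proof.
elim: n => [|n IH] pm qm pq i.
  by case: i => // _; apply: edge_min_uniq pq; [exact: pm|exact: qm].
have E : path_edge p n.+1 = path_edge q n.+1.
  by apply: edge_min_uniq pq; [exact: pm|exact: qm].
rewrite ltnS leq_eqVlt => /predU1P[->//|]; apply: IH => [j jn|j jn|].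
- exact: pm (ltnW jn).
- exact: qm (ltnW jn).
- by rewrite !path_edge_src E.
Qed.

Variable lam : path_set B -> path_set B.
Hypothesis lamV : vershik_map lam.

Lemma vershik_nonmax n p : ~ max_prefix n p ->
  exists2 k, (k < n)%N & ~ edge_max (path_edge p k) /\
    (forall i, (i < k)%N -> edge_max (path_edge p i)) /\
    edge_succ (path_edge p k) (path_edge (lam p) k) /\
    (forall i, (i < k)%N -> edge_min (path_edge (lam p) i)) /\
    (forall i, (k < i)%N -> path_edge (lam p) i = path_edge p i).
Proof.
move=> pn; have [_ /(_ _)[|k [kN km ks kmin kt]]] := lamV p.
  by move=> pm; apply: pn => i _; exact: pm.
exists k => //.
by rewrite ltnNge; apply/negP => nk; apply: pn => i i_n; apply: km; exact: leq_trans nk.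
Qed.

(** The first non-maximal edge lies inside the prefix, and its successor determines the minimal path
    below it. *)
Lemma agree_below_vershik n p q : agree_below n p q -> ~ max_prefix n p ->
  agree_below n (lam p) (lam q).
Proof.
move=> pq pn; have qn : ~ max_prefix n q.
  by move=> qm; apply: pn => i i_n; rewrite pq//; exact: qm.
have [k kn [pk [pm [ps [pmin pt]]]]] := vershik_nonmax pn.
have [k' kn' [qk [qm [qs [qmin qt]]]]] := vershik_nonmax qn.
have kk' : k = k'.
  have [lt|lt|//] := ltngtP k k'.
    by case: pk; rewrite pq//; exact: qm.
  by case: qk; rewrite -pq//; exact: pm.
subst k'.
have E : path_edge (lam p) k = path_edge (lam q) k.
  by rewrite pq// in ps; exact: edge_succ_uniq ps qs.
move=> i i_n; have [lt|lt|->//] := ltngtP i k.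
- case: k E pmin qmin lt {kn pk pm ps pt kn' qk qm qs qt} => // k E pmin qmin ik.
  by apply: (min_prefix_uniq pmin qmin _ ik); rewrite !path_edge_src E.
- by rewrite pt// qt// pq.
Qed.

Lemma max_prefix_vershik n p : max_prefix n p -> min_prefix n (lam p).
Proof.
move=> pm; have [pmax pnmax] := lamV p.
have [/pmax pmin i _|/pnmax[k [kN _ _ kmin _]] i i_n] := pselect (path_max p).
  exact: pmin.
apply: kmin; apply: leq_trans i_n _; rewrite leqNgt; apply/negP => kn.
by apply: kN; exact: pm.
Qed.

Definition above n (e : edge B n) : nat := #|[pred f | ele e f]|.

Lemma edge_succ_above n (e f : edge B n) : edge_succ e f -> (above f < above e)%N.
Proof.
move=> [ef nef _]; apply: proper_card; apply/properP; split.
  by apply/fintype.subsetP => g; rewrite !inE; exact: ele_trans ef.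
exists e; first by rewrite inE ele_refl.
rewrite inE; apply/negP => fe; apply: nef.
by apply: (@ele_anti B n); rewrite ef fe.
Qed.

Lemma max_prefix_reached n p : exists t, max_prefix n (iter t lam p) /\
  forall i, (n <= i)%N -> path_edge (iter t lam p) i = path_edge p i.
Proof.
elim: n p => [|n IH] p; first by exists 0%N.
have [a] := ubnP (above (path_edge p n)); elim: a p => // a IHa p ap.
have [t [tmax tt]] := IH p; set q := iter t lam p in tmax tt.
have [qn|qn] := pselect (edge_max (path_edge q n)).
  exists t; split=> [i|i ni]; last by apply: tt; exact: ltnW.
  by rewrite ltnS leq_eqVlt => /predU1P[->//|]; exact: tmax.
have qN : ~ max_prefix n.+1 q by move=> /(_ n (ltnSn n)).
have [k kn [kN [_ [ks [_ kt]]]]] := vershik_nonmax qN.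
have kE : k = n.
  apply/eqP; rewrite eqn_leq -ltnS kn leqNgt; apply/negP => lt.
  by apply: kN; exact: tmax.
subst k.
have [|t' [t'max t't]] := IHa (lam q).
  by apply: leq_trans (edge_succ_above ks) _; rewrite tt.
exists (t' + t.+1)%N; rewrite iterD iterS -/q; split => // i ni.
by rewrite t't// kt// tt// ltnW.
Qed.

(** * Sums along the towers of one level, and the transfer function they define *)

Section Transfer.
Variable n : nat.

Lemma exit_ex p : exists t, `[< max_prefix n (iter t lam p) >].
Proof. by have [t [tm _]] := max_prefix_reached n p; exists t; apply/asboolP. Qed.

Definition exit_time p : nat := ex_minn (exit_ex p).

Lemma exit_time_max p : max_prefix n p -> exit_time p = 0%N.
Proof.
by move=> pm; rewrite /exit_time; case: ex_minnP => t _ /(_ 0%N (asboolT pm)); lia.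
Qed.

Lemma exit_time_vershik p : ~ max_prefix n p -> exit_time p = (exit_time (lam p)).+1.
Proof.
move=> pN; rewrite /exit_time; case: ex_minnP => t /asboolP tm tmin.
case: ex_minnP => s /asboolP sm smin; apply/eqP; rewrite eqn_leq; apply/andP; split.
  by apply: tmin; apply/asboolP; rewrite iterSr.
case: t tm {tmin} => // t tm; rewrite ltnS; apply: smin; apply/asboolP.
by rewrite -iterSr.
Qed.

(** The sum from p up to the top of its tower, top included; over the whole tower when p has a
    minimal prefix. *)
Definition tower_sum (g : path_set B -> rat) p : rat :=
  \sum_(t < (exit_time p).+1) g (iter t lam p).

Lemma tower_sum_max g p : max_prefix n p -> tower_sum g p = g p.
Proof. by move=> pm; rewrite /tower_sum exit_time_max// big_ord1. Qed.

Lemma tower_sum_vershik g p : ~ max_prefix n p ->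
  tower_sum g p = g p + tower_sum g (lam p).
Proof.
move=> pN; rewrite /tower_sum exit_time_vershik// big_ord_recl/=; congr (_ + _).
by apply: eq_bigr => t _; rewrite -iterSr.
Qed.

Lemma tower_sum_same g p q : (forall p q, agree_below n p q -> g p = g q) ->
  agree_below n p q -> tower_sum g p = tower_sum g q.
Proof.
move=> gn; have [t] := ubnP (exit_time p); elim: t p q => // t IH p q pt pq.
have [pm|pN] := pselect (max_prefix n p).
  rewrite !tower_sum_max//; first exact: gn.
  by move=> i i_n; rewrite -pq//; exact: pm.
have qN : ~ max_prefix n q.
  by move=> qm; apply: pN => i i_n; rewrite pq//; exact: qm.
rewrite (tower_sum_vershik g pN) (tower_sum_vershik g qN); congr (_ + _); first exact: gn.
by apply: IH; [rewrite exit_time_vershik in pt|exact: agree_below_vershik].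
Qed.

End Transfer.

(** The tower sum S is a transfer function, g = S - S o lam. Below the top this is the definition;
    at the top S is g itself, and the next point lies at the base of a tower, where S vanishes by
    hypothesis. *)
Lemma coboundary_sum n g p : (forall q, min_prefix n q -> tower_sum n g q = 0) ->
  forall t, \sum_(i < t) g (iter i lam p) = tower_sum n g p - tower_sum n g (iter t lam p).
Proof.
move=> g0; elim=> [|t IH]; first by rewrite big_ord0 subrr.
rewrite big_ord_recr/= IH; set q := iter t lam p.
have [qm|qN] := pselect (max_prefix n q).
  by rewrite (tower_sum_max g qm) (g0 _ (max_prefix_vershik qm)); ring.
by rewrite (tower_sum_vershik g qN); ring.
Qed.

Lemma tower_sum_lin n (I : finType) (m : I -> rat) (f : I -> path_set B -> rat) p :
  tower_sum n (fun q => \sum_j m j * f j q) p = \sum_j m j * tower_sum n (f j) p.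
Proof.
rewrite /tower_sum exchange_big/=; apply: eq_bigr => j _.
by rewrite mulr_sumr.
Qed.

End Paths.

Lemma kernel_vector (N d : nat) (M : 'M[rat]_(N, d)) : (d < N)%N ->
  exists2 m : 'I_N -> rat, (exists j, m j != 0) & forall v, \sum_j m j * M j v = 0.
Proof.
move=> dN; have /rowV0Pn[u uM u0] : kermx M != 0.
  by rewrite -mxrank_eq0 mxrank_ker subn_eq0 -ltnNge (leq_ltn_trans (rank_leq_col M)).
exists (fun j => u ord0 j) => [|v].
  by have /rV0Pn[j uj] := u0; exists j.
by have /sub_kermxP/matrixP/(_ ord0 v) := uM; rewrite !mxE.
Qed.

(* A kernel vector [m] of the matrix of tower sums makes the combination of the
   [f j] sum to zero along every tower, hence a coboundary. *)
Lemma topological_rank_sums (X : topologicalType) (T : X -> X) (d N : nat)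
    (f : 'I_N -> X -> rat) :
  topological_rank_le T d -> (d < N)%N ->
  (forall j x, nbhs x [set x' | f j x' = f j x]) ->
  exists2 m : 'I_N -> rat, (exists j, m j != 0) &
    exists C : rat, forall x t, `|\sum_(i < t) \sum_j m j * f j (iter i T x)| <= C.
Proof.
move=> [[[_ cX _ _] _ _] _ [B [lam [_ lamV [phi [cphi [psi [cpsi phiK psiK]]] phiT] BV]]]] dN fc.
have EB := path_cylinder_basis B.
(* One level at which all [f j] depend on the prefix only. It is taken as n+1 so that the prefix has
   a last edge, whose range names the tower. *)
have [|x|n nP] := @compact_uniform X (fun n => [set x | forall x',
    agree_below n.+1 (phi x) (phi x') -> forall j, f j x = f j x']) cX.
- move=> m n mn x /= H x' xx'; apply: H; apply: (cyl_mono EB) xx'.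
  by rewrite ltnS.
- have [n nP] : exists n, forall x', agree_below n (phi x) (phi x') ->
      forall j, f j x = f j x'.
    have : nbhs (phi x) [set q | forall j, f j (psi q) = f j x].
      apply: (@cpsi (phi x) [set x' | forall j, f j x' = f j x]).
      by rewrite phiK; apply: filter_forall => j; exact: fc.
    move=> /(cyl_nbhs EB)[n nP]; exists n => x' /nP /= H j.
    by rewrite -(H j) phiK.
  exists n; apply: (@filterS _ (nbhs x) _ (phi @^-1` (agree_below n.+1 (phi x)))).
    move=> y /= xy x' yx' j.
    have sub (p q : path_set B) : agree_below n.+1 p q -> agree_below n p q.
      by move=> pq i i_n; apply: pq; exact: ltnW.
    rewrite -(nP y (sub _ _ xy)) (nP x')//; apply: sub.
    exact: (cyl_trans EB) xy yx'.
  exact: cphi (cyl_nbhs_cylinder EB n.+1 (phi x)).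
pose F j q := f j (psi q).
have FE j p q : agree_below n.+1 p q -> F j p = F j q.
  by move=> pq; apply: nP; rewrite !psiK.
(* Entry (j, v) is the sum of [f j] over the tower of v. All minimal paths to v share their prefix,
   so the choice is immaterial; 0 is a default for the absence of a path. *)
pose M := \matrix_(j < N, v < #|vertex B n.+1|)
  if pselect (exists2 q, min_prefix n.+1 q & rng (path_edge q n) = enum_val v)
    is left ex then tower_sum lamV n.+1 (F j) (s2val (cid2 ex)) else 0.
have [|m m0 mM] := kernel_vector M; first exact: leq_ltn_trans (BV n) dN.
exists m => //; pose g q := \sum_j m j * F j q.
have gE p q : agree_below n.+1 p q -> g p = g q.
  by move=> pq; apply: eq_bigr => j _; rewrite (FE j _ _ pq).
have g0 q : min_prefix n.+1 q -> tower_sum lamV n.+1 g q = 0.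
  move=> qm; rewrite tower_sum_lin -[RHS](mM (enum_rank (rng (path_edge q n)))).
  apply: eq_bigr => j _; congr (_ * _); rewrite mxE; case: pselect => [ex|[]]; last first.
    by exists q; rewrite ?enum_rankK.
  case: cid2 => /= q' q'm q'q; apply: tower_sum_same (FE j) _.
  by apply: min_prefix_uniq => //; rewrite q'q enum_rankK.
(* The transfer function depends on a prefix only, hence is locally constant and, by compactness,
   bounded. *)
have [C CP] : exists C : rat, forall x, `|tower_sum lamV n.+1 g (phi x)| <= C.
  have [|x|c cP] := @compact_uniform X (fun c => [set x |
      `|tower_sum lamV n.+1 g (phi x)| <= c%:R]) cX.
  - by move=> a b ab x /= /le_trans; apply; rewrite ler_nat.
  - exists (Num.bound `|tower_sum lamV n.+1 g (phi x)|).
    apply: (@filterS _ (nbhs x) _ (phi @^-1` (agree_below n.+1 (phi x)))).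
      by move=> y /= xy; rewrite -(tower_sum_same lamV gE xy) ltW// archi_boundP.
    exact: cphi (cyl_nbhs_cylinder EB n.+1 (phi x)).
  - by exists c%:R.
exists (C + C) => x t.
have itE i : phi (iter i T x) = iter i lam (phi x).
  by elim: i => // i IH; rewrite !iterS phiT IH.
have -> : \sum_(i < t) \sum_j m j * f j (iter i T x) = \sum_(i < t) g (iter i lam (phi x)).
  by apply: eq_bigr => i _; apply: eq_bigr => j _; rewrite /F -itE phiK.
rewrite (coboundary_sum (phi x) g0) -itE.
by apply: le_trans (ler_normB _ _) _; apply: lerD; exact: CP.
Qed.

(** * The rank-one subshift *)

Section Word.
Variable k : nat.
Local Notation r := k.+3.

Definition toeplitz_word (n : nat) : bool := ruler_word k n%:Z.

Definition ruler_prefix (m : nat) : seq bool :=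
  false :: flatten [seq rcons (nseq (ruler k t%:Z) true) false | t <- iota 1 m].

Lemma ruler_prefixS m : ruler_prefix m.+1 =
  ruler_prefix m ++ rcons (nseq (ruler k m.+1%:Z) true) false.
Proof.
by rewrite /ruler_prefix -[m.+1]addn1 iotaD map_cat flatten_cat /= cats0 add1n addn1.
Qed.

Lemma ruler_prefix_word m n : (n < size (ruler_prefix m))%N ->
  toeplitz_word n = nth false (ruler_prefix m) n.
Proof.
have [P xP P0] := ruler_word_coding k; have [PS Px] := xP.
suff [_ H] : (size (ruler_prefix m))%:Z = P m%:Z + 1 /\
    forall n, (n < size (ruler_prefix m))%N ->
      toeplitz_word n = nth false (ruler_prefix m) n by exact: H.
elim: m {n} => [|m [IHs IH]].
  rewrite P0; split => // -[_|//]; rewrite /toeplitz_word.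
  by rewrite -[Posz 0]P0; exact: coding_zero xP.
have PE : P m.+1%:Z = P m%:Z + (ruler k m.+1%:Z).+1%:Z.
  by have := PS m%:Z; rewrite -PoszD addn1 -PoszD add1n.
rewrite ruler_prefixS; split.
  by rewrite size_cat PoszD IHs size_rcons size_nseq PE; ring.
move=> n; rewrite size_cat size_rcons size_nseq nth_cat.
case: (ltnP n (size (ruler_prefix m))) => [lt _|le lt]; first exact: IH.
have [j nE] : exists j, n = (size (ruler_prefix m) + j)%N.
  by exists (n - size (ruler_prefix m))%N; rewrite subnKC.
rewrite nE addKn nth_rcons size_nseq nth_nseq /toeplitz_word PoszD IHs.
have -> : P m%:Z + 1 + j%:Z = P m%:Z + j.+1%:Z by lia.
case: (ltngtP j (ruler k m.+1%:Z)) => jm.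
- by rewrite Px// -PoszD add1n.
- by move: lt; rewrite nE; lia.
- by rewrite jm -PE; exact: coding_zero xP.
Qed.

Lemma rulerMexp (n : nat) (m : int) : ruler k ((r ^ n)%N%:Z * m) = ruler k m.
Proof.
elim: n => [|n IH]; first by rewrite expn0 mul1r.
by rewrite expnS PoszM -mulrA rulerM.
Qed.

(** The block v_n has r^n zeros, hence r^n - 1 exponents. The spacer after copy c of v_n is exponent
    number c r^n, where [ruler] is c - 1; inside a copy, translation by c r^n does not change
    [ruler]. *)
Lemma rank1_block_prefix n :
  rank1_block (fun _ => r) (fun _ i => i.-1) n = ruler_prefix (r ^ n).-1.
Proof.
elim: n => [//|n IH]; rewrite /= IH; set M := (r ^ n)%N.
have M0 : (0 < M)%N by rewrite expn_gt0.
suff H c : (c < r)%N -> ruler_prefix M.-1 ++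
    flatten [seq nseq i.-1 true ++ ruler_prefix M.-1 | i <- iota 1 c] =
    ruler_prefix (c.+1 * M).-1 by rewrite expnS -/M -H.
elim: c => [|c IHc] cr; first by rewrite cats0 mul1n.
have -> : iota 1 c.+1 = iota 1 c ++ [:: c.+1].
  by rewrite -[c.+1]addn1 iotaD add1n addn1.
rewrite map_cat flatten_cat catA IHc 1?ltnW//.
have -> : ((c.+2 * M).-1 = (c.+1 * M).-1 + M)%N by rewrite [in LHS]mulSn; nia.
rewrite /ruler_prefix iotaD map_cat flatten_cat -[_ ++ _]/(_ :: (_ ++ _)).
congr (_ :: (_ ++ _)); rewrite /= cats0 add1n.
have -> : iota (c.+1 * M).-1.+1 M = [seq (c.+1 * M + t)%N | t <- 0%N :: iota 1 M.-1].
  rewrite (_ : (c.+1 * M).-1.+1 = c.+1 * M + 0)%N; last by nia.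
  by rewrite iotaDl (_ : 0%N :: iota 1 M.-1 = iota 0 M.-1.+1)// prednK.
rewrite /= addn0.
rewrite (_ : (c.+1 * M)%N%:Z = (r ^ n)%N%:Z * c.+1%:Z); last by rewrite mulrC -PoszM.
rewrite rulerMexp ruler_small// -cats1 -catA /=; congr (_ ++ _ :: flatten _).
rewrite -map_comp; apply/eq_in_map => t; rewrite mem_iota => tM /=.
by rewrite ruler_expDn//; lia.
Qed.

Lemma rank1_toeplitz_word : rank1_word toeplitz_word.
Proof.
exists (fun _ => r), (fun _ i => i.-1); split => // n m.
by rewrite rank1_block_prefix => /ruler_prefix_word.
Qed.

Local Notation XV := (rank1_shift toeplitz_word).

Lemma rank1_shift_language (x : biseq) : XV x <->
  forall (m : int) (L : nat), exists n : nat, forall i : nat, (i < L)%N ->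
    x (m + i%:Z) = ruler_word k (n%:Z + i%:Z).
Proof.
split=> [Xx m L|xL w [m wm]].
  have [|n nw] := Xx (mkseq (fun i => x (m + i%:Z)) L).
    by exists m => i; rewrite size_mkseq => iL; rewrite nth_mkseq.
  by exists n => i iL; have := nw i; rewrite size_mkseq nth_mkseq// => ->.
have [n nx] := xL m (size w); exists n => i iw.
by rewrite wm// nx.
Qed.

Lemma rank1_shift_coding (x : biseq) :
  XV x <-> exists P y, coding x P y /\ toeplitz k y.
Proof.
rewrite rank1_shift_language; split=> [|[P [y [xP Ty]]]].
  exact: ruler_word_language_coding.
exact: ruler_word_language xP Ty.
Qed.

Lemma rank1_shift_frame (x : biseq) :
  XV x <-> exists i y, frame x i y /\ toeplitz k y.
Proof.
rewrite rank1_shift_coding; split=> [[P [y [xP Ty]]]|[i [y [[_ [P xP _]] Ty]]]].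
  have [i [a xi]] := coding_frame xP; exists i, (fun t => y (a + t)).
  by split => //; exact: toeplitz_shift.
by exists P, y.
Qed.

Lemma iter_shift (n : nat) (x : biseq) : iter n shift_map x = fun m => x (m + n%:Z).
Proof.
apply: funext => m; elim: n m => [|n IH] m; first by rewrite addr0.
by rewrite iterS /shift_map IH; congr x; lia.
Qed.

Definition unshift (x : biseq) : biseq := fun n => x (n - 1).

Lemma shiftK : cancel shift_map unshift.
Proof. by move=> x; apply: funext => n; rewrite /unshift /shift_map subrK. Qed.

Lemma unshiftK : cancel unshift shift_map.
Proof. by move=> x; apply: funext => n; rewrite /unshift /shift_map addrK. Qed.

Lemma rank1_shift_unshift (x : biseq) : XV x -> XV (unshift x).
Proof.
move=> /rank1_shift_language xL; apply/rank1_shift_language => m L.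
have [n nx] := xL (m - 1) L; exists n => i iL.
by rewrite -nx// /unshift addrAC.
Qed.

Lemma bool_discrete (i : int) (b : bool) : nbhs b [set b].
Proof. exact: discrete_set1. Qed.

Lemma rank1_shift_closed : closed XV.
Proof.
move=> x xX w [m wm].
have [y [Xy yx]] := xX _ (nbhs_cylinder bool_discrete x
  [seq m + i%:Z | i <- iota 0 (size w)]).
apply: Xy; exists m => i iw; rewrite wm//; apply: yx.
by apply: map_f; rewrite mem_iota.
Qed.

(** The window of x' occurs somewhere in V, and x contains every prefix of V, in particular one
    reaching past that occurrence. *)
Lemma rank1_shift_orbit (x x' : biseq) (L : nat) : XV x -> XV x' ->
  exists2 z, zorbit shift_map x z & forall m : int, (`|m| <= L)%N -> z m = x' m.
Proof.
move=> /rank1_shift_coding[P [y [xP Ty]]] /rank1_shift_language x'L.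
have [n nx'] := x'L (- L%:Z) (2 * L).+1.
have [a ax] := ruler_word_recurrent xP Ty (n + (2 * L).+1).
pose b := a + n%:Z + L%:Z; exists (fun m => x (m + b)).
  case: (ltP b 0) => b0; exists `|b|%N; [right|left]; rewrite iter_shift.
    by apply: funext => m /=; congr x; lia.
  by apply: funext => m /=; congr x; lia.
move=> m mL; have := nx' `|(m + L%:Z)%R|%N; rewrite -PoszD -ax; last by lia.
rewrite (_ : - L%:Z + _ = m); last by lia.
rewrite (_ : a + _ = m + b); last by rewrite /b; lia.
by move=> ->//; lia.
Qed.

Lemma seq_int_bound (s : seq int) : exists L : nat, forall i, i \in s -> (`|i| <= L)%N.
Proof.
elim: s => [|j s [L sL]]; first by exists 0%N.
by exists (`|j| + L)%N => i; rewrite inE => /predU1P[->|/sL]; lia.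
Qed.

Lemma minimal_toeplitz_word : minimal_subshift XV.
Proof.
split; first split; first exact: rank1_shift_closed.
  apply/seteqP; split=> [_ [x Xx <-]|x Xx]; first exact: rank1_shift_stable.
  by exists (unshift x); [exact: rank1_shift_unshift|exact: unshiftK].
move=> x Xx x' Xx' W /(nbhs_sub_cylinder)[s sW]; have [L sL] := seq_int_bound s.
have [z xz zx'] := rank1_shift_orbit L Xx Xx'; exists z; split => //.
by apply: sW => i /sL iL; rewrite zx'.
Qed.

(** * X_V as a compact system with a single minimal set *)

Definition window (n : nat) (x y : XV) : Prop :=
  forall m : int, (`|m| <= n)%N -> set_val x m = set_val y m.

Lemma window_basis : cylinder_basis window.
Proof.
pose dom (n : nat) := [seq i%:Z - n%:Z | i <- iota 0 (2 * n).+1].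
have domE n m : (m \in dom n) = (`|m| <= n)%N.
  apply/mapP/idP => [[i]|mn]; first by rewrite mem_iota => i_n ->; lia.
  by exists `|(m + n%:Z)%R|%N; [rewrite mem_iota|]; lia.
have := @prod_cylinder_basis int (fun _ => bool) bool_discrete dom XV.
rewrite (_ : (fun n (x y : XV) => forall i, i \in dom n -> set_val x i = set_val y i) = window).
  apply=> [m n mn i|i]; first by rewrite !domE => /leq_trans; exact.
  by exists `|i|%N; rewrite domE.
apply: funext => n; apply: funext => x; apply: funext => y; apply: propext.
by split=> H m mn; apply: H; rewrite ?domE// -domE.
Qed.

Local Notation T := (@rank1_map toeplitz_word).

Definition rank1_unmap (x : XV) : XV :=
  exist _ (unshift (set_val x)) (mem_set (rank1_shift_unshift (set_valP x))).

Lemma rank1_map_homeomorphism : homeomorphism T.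
Proof.
split.
  apply/(cylinder_continuous window_basis window_basis) => x n.
  by exists n.+1 => y xy m mn; apply: xy; lia.
exists rank1_unmap; split.
- apply/(cylinder_continuous window_basis window_basis) => x n.
  by exists n.+1 => y xy m mn; apply: xy; lia.
- by move=> x; apply: val_inj; exact: shiftK.
- by move=> x; apply: val_inj; exact: unshiftK.
Qed.

Lemma rank1_shift_compact : compact [set: XV].
Proof.
apply: compact_set_type; apply: subclosed_compact rank1_shift_closed _ _.
  exact: (@tychonoff int (fun _ => bool) (fun _ => setT) (fun _ => bool_compact)).
by move=> x _ i.
Qed.

Lemma rank1_invariant_closed (Z : set XV) : invariant_closed T Z -> Z = setT.
Proof.
move=> [cZ [z0 Zz0] TZ]; apply/seteqP; split => // x' _; apply: cZ => U Ux'.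
have /(cyl_nbhs window_basis)[L LU] := Ux'.
have [z [n zE] zx'] := rank1_shift_orbit L (set_valP z0) (set_valP x').
have fwd (m : nat) (u : XV) : set_val (iter m T u) = iter m shift_map (set_val u).
  by elim: m => // m IH; rewrite !iterS -IH.
(* The forward orbit stays in Z because T Z is in Z; on the backward side T Z = Z supplies preimages
   inside Z, and injectivity of the shift identifies them. *)
have [u Zu uz] : exists2 u, Z u & set_val u = z.
  case: zE => [<-|zE].
    exists (iter n T z0); last exact: fwd.
    by elim: n => // n IH; rewrite iterS -TZ; exists (iter n T z0).
  have [u Zu uE] : exists2 u, Z u & iter n T u = z0.
    elim: n {zE} => [|n [u Zu uE]]; first by exists z0.
    by move: Zu; rewrite -{1}TZ => -[v Zv vu]; exists v; rewrite // iterSr vu.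
  have : iter n shift_map (set_val u) = iter n shift_map z by rewrite -fwd uE zE.
  rewrite !iter_shift => E; exists u => //.
  apply: funext => m; have := congr1 (fun f : biseq => f (m - n%:Z)) E.
  by rewrite subrK.
by exists u; split => //; apply: LU => m mL; rewrite uz zx'.
Qed.

Lemma rank1_essentially_minimal : (exists x, XV x) -> essentially_minimal T.
Proof.
move=> [x Xx]; have [_ [g [_ _ gK]]] := rank1_map_homeomorphism.
have inv : invariant_closed T setT.
  split; [exact: closedT|by exists (exist _ x (mem_set Xx))|].
  by apply/seteqP; split => // y _; exists (g y).
exists setT; split; first by split => // Z /rank1_invariant_closed.
by move=> Z [/rank1_invariant_closed ->].
Qed.

End Word.

(** * The Bratteli-Vershik model *)

Section Diagram.
Variable k : nat.

Definition tvertex (n : nat) : finType := 'I_(if n is 0%N then 1 else k.+2).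

(** An edge (j, i) is place i in the word substituted for j; its range is j and its source the
    letter found there. At the first level the word is 0 1^j instead, with places 0, ..., j, so the
    first tower over j has height j+1. *)
Definition tedge (n : nat) : finType :=
  {p : 'I_k.+2 * 'I_k.+3 | (n == 0%N) ==> (p.2 <= p.1)%N}.

Definition tsrc (n : nat) : tedge n -> tvertex n :=
  match n with
  | 0 => fun _ => ord0
  | m.+1 => fun e => inord (subst_letter k (\val e).1 (\val e).2)
  end.

Definition trng (n : nat) (e : tedge n) : tvertex n.+1 := (\val e).1.

Definition tele (n : nat) : rel (tedge n) :=
  fun e f => ((\val e).1 == (\val f).1) && ((\val e).2 <= (\val f).2)%N.

Lemma tedge_eq n (e f : tedge n) :
  (\val e).1 = (\val f).1 :> nat -> (\val e).2 = (\val f).2 :> nat -> e = f.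
Proof.
move=> ef1 ef2; apply: val_inj; rewrite [LHS]surjective_pairing.
by rewrite [RHS]surjective_pairing; congr pair; exact: val_inj.
Qed.

Lemma tedge_exists n (j i : nat) : (j < k.+2)%N -> (i < k.+3)%N ->
  ((n == 0%N) ==> (i <= j)%N) ->
  exists e : tedge n, (\val e).1 = j :> nat /\ (\val e).2 = i :> nat.
Proof.
move=> jk ik ij.
pose P (p : 'I_k.+2 * 'I_k.+3) := (n == 0%N) ==> (p.2 <= p.1)%N.
have h : P (inord j, inord i) by rewrite /P /= !inordK.
by exists (exist P (inord j, inord i) h) => /=; rewrite !inordK.
Qed.

Lemma subst_letter_lt (j i : nat) : (j < k.+2)%N -> (i < k.+3)%N ->
  (subst_letter k j i < k.+2)%N.
Proof. by rewrite /subst_letter; case: eqP => // _; case: eqP => // _; lia. Qed.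

Lemma tsrcS n (e : tedge n.+1) :
  tsrc e = subst_letter k (\val e).1 (\val e).2 :> nat.
Proof. by rewrite /= inordK// subst_letter_lt. Qed.

Definition tdiagram : ordered_bratteli.
Proof.
refine (@OrderedBratteli tvertex tedge tsrc trng tele _ _ _ _ _ _ _ _ _).
- by rewrite card_ord.
- by case=> [|n]; rewrite card_ord.
- move=> n; have [//|//||e _] := @tedge_exists n 0 0; first by rewrite implybT.
  by apply/card_gt0P; exists e.
- case=> [|n] v.
    by have [//|//|//|e _] := @tedge_exists 0 0 0; exists e; apply: val_inj; case: v => -[].
  have [//|//|//|e [e1 e2]] := @tedge_exists n.+1 v 1; exists e.
  by apply: (@ord_inj k.+2); rewrite tsrcS e1 e2.
- move=> n v; have [//|//||e [e1 e2]] := @tedge_exists n v 0; first by rewrite implybT.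
  by exists e; apply: (@ord_inj k.+2).
- by move=> n e; rewrite /tele eqxx leqnn.
- move=> n e f /andP[/andP[/eqP ef1 ef2] /andP[_ fe2]].
  by apply: tedge_eq; [rewrite ef1|apply/eqP; rewrite eqn_leq ef2].
- move=> n f e g /andP[/eqP ef1 ef2] /andP[/eqP fg1 fg2].
  by rewrite /tele ef1 fg1 eqxx (leq_trans ef2 fg2).
- move=> n e f; rewrite /tele /trng (eq_sym (\val f).1) -andb_orr leq_total andbT.
  by split=> [/eqP|->].
Defined.

Local Notation B := tdiagram.
Implicit Types p q : path_set B.

Definition pl p n : nat := (\val (path_edge p n : tedge n)).1.
Definition pd p n : nat := (\val (path_edge p n : tedge n)).2.

Lemma pl_lt p n : (pl p n < k.+2)%N. Proof. exact: ltn_ord. Qed.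
Lemma pd_lt p n : (pd p n < k.+3)%N. Proof. exact: ltn_ord. Qed.

Lemma pd0_le p : (pd p 0 <= pl p 0)%N.
Proof. by have := valP (path_edge p 0 : tedge 0). Qed.

Lemma pl_subst p n : pl p n = subst_letter k (pl p n.+1) (pd p n.+1).
Proof. by rewrite -tsrcS -[tsrc _](path_edge_src p n). Qed.

Lemma path_edge_eq p q n : pl p n = pl q n -> pd p n = pd q n ->
  path_edge p n = path_edge q n.
Proof. exact: tedge_eq. Qed.

Lemma path_exists (l d : nat -> nat) : (forall n, (l n < k.+2)%N) ->
  (forall n, (d n < k.+3)%N) -> (d 0 <= l 0)%N ->
  (forall n, l n = subst_letter k (l n.+1) (d n.+1)) ->
  exists p, forall n, pl p n = l n /\ pd p n = d n.
Proof.
move=> lk dk dl ls.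
have ex n : exists e : tedge n, (\val e).1 = l n :> nat /\ (\val e).2 = d n :> nat.
  by apply: tedge_exists => //; case: eqP => // ->.
pose e n := projT1 (cid (ex n)).
have eE n : (\val (e n)).1 = l n :> nat /\ (\val (e n)).2 = d n :> nat.
  exact: projT2 (cid (ex n)).
have pe : path_set B e.
  move=> n; apply: (@ord_inj k.+2); have [eE1 eE2] := eE n.+1.
  by rewrite [RHS]tsrcS eE1 eE2 -ls; exact: (eE n).1.
by exists (exist _ (e : edge_seq B) (mem_set pe)); exact: eE.
Qed.

Definition pd_max p n : nat := if n is 0%N then pl p 0 else k.+2.

Lemma edge_maxP p n : edge_max (path_edge p n) <-> pd p n = pd_max p n.
Proof.
have dm : (pd p n <= pd_max p n)%N.
  by case: n => [|n]; [exact: pd0_le|rewrite -ltnS; exact: pd_lt].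
split=> [pmax|pmax e' /andP[/eqP e1 e2]].
  have [||//|e [e1 e2]] := @tedge_exists n (pl p n) (pd_max p n).
  - exact: pl_lt.
  - by case: n {dm pmax} => [|n] //=; have := pl_lt p 0; lia.
  - by case: n {dm pmax} => [|n] //; exact: leqnn.
  rewrite -e2 (pmax e)//; apply/andP; split; last by rewrite e2.
  by apply/eqP/ord_inj; rewrite e1.
apply: tedge_eq; first by rewrite -e1.
apply/eqP; rewrite eqn_leq e2 andbT -/(pd p n) pmax.
case: n e' e1 {dm pmax e2} => [|n] e' e1 /=; last by rewrite -ltnS.
by rewrite /pl e1; exact: (valP e').
Qed.

Lemma edge_minP p n : edge_min (path_edge p n) <-> pd p n = 0%N.
Proof.
split=> [pmin|pmin e' /andP[/eqP e1 e2]].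
  have [||//|e [e1 e2]] := @tedge_exists n (pl p n) 0.
  - exact: pl_lt.
  - by [].
  - by rewrite implybT.
  rewrite -e2 (pmin e)//; apply/andP; split; last by rewrite e2.
  by apply/eqP/ord_inj; rewrite e1.
apply: tedge_eq; first by rewrite -e1.
by apply/eqP; rewrite eqn_leq e2 -/(pd p n) pmin.
Qed.

Lemma edge_succP p q n : pl p n = pl q n -> pd q n = (pd p n).+1 ->
  edge_succ (path_edge p n) (path_edge q n).
Proof.
move=> pq1 pq2; split.
- apply/andP; split; first by apply/eqP/ord_inj.
  by rewrite -/(pd p n) -/(pd q n) pq2.
- by move=> E; move: pq2; rewrite /pd E; lia.
- move=> g /andP[/eqP g1 g2] /andP[/eqP h1 h2].
  have : (pd p n == (\val g).2 :> nat) || (pd q n == (\val g).2 :> nat).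
    by move: g2 h2; rewrite -/(pd p n) -/(pd q n) pq2; lia.
  case/orP=> /eqP E; [left|right]; apply: tedge_eq; rewrite -?E//.
    by rewrite -g1.
  by rewrite h1.
Qed.

(** Every substituted word ends in k and begins with k+1, so all vertices of a maximal path are k
    and all those of a minimal path are k+1. *)
Lemma tdiagram_essentially_simple : essentially_simple B.
Proof.
split.
  have [|||n|p pE] := @path_exists (fun _ => k) (fun n => if n is 0%N then k else k.+2).
  - by [].
  - by case=> [|n]; lia.
  - by [].
  - by [].
  exists p; split=> [n|q qm].
    by apply/edge_maxP; have [pl_n ->] := pE n; case: n pl_n => //= <-.
  have ql n : pl q n = k.
    by rewrite pl_subst; have /edge_maxP -> := qm n.+1.
  apply: val_inj; apply: functional_extensionality_dep => n.
  have [pln pdn] := pE n; apply: path_edge_eq; first by rewrite ql.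
  have /edge_maxP -> := qm n; rewrite pdn; case: n {pln pdn} => //=.
have [|||n|p pE] := @path_exists (fun _ => k.+1) (fun _ => 0%N) => //.
exists p; split=> [n|q qm]; first by apply/edge_minP; have [] := pE n.
have ql n : pl q n = k.+1.
  by rewrite pl_subst; have /edge_minP -> := qm n.+1.
apply: val_inj; apply: functional_extensionality_dep => n.
have [pln pdn] := pE n; apply: path_edge_eq; first by rewrite ql.
by have /edge_minP -> := qm n.
Qed.

(** * From points of X_V to paths: iterated desubstitution *)

Lemma desubst_choice : exists F : (int -> nat) -> nat * (int -> nat),
  forall y, toeplitz k y ->
    [/\ ((F y).1 < k.+3)%N, toeplitz k (F y).2 & desubst k (F y).1 (F y).2 y].
Proof.
have ex (y : int -> nat) : exists F : nat * (int -> nat), toeplitz k y ->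
    [/\ (F.1 < k.+3)%N, toeplitz k F.2 & desubst k F.1 F.2 y].
  have [Ty|nT] := pselect (toeplitz k y); last by exists (0%N, y).
  by have [i [z [ir Tz yz]]] := desubst_exists Ty; exists (i, z).
by have [F FP] := choice ex; exists F.
Qed.

Definition phase (y : int -> nat) : nat := (projT1 (cid desubst_choice) y).1.
Definition renorm (y : int -> nat) : int -> nat := (projT1 (cid desubst_choice) y).2.

Lemma renormP y : toeplitz k y ->
  [/\ (phase y < k.+3)%N, toeplitz k (renorm y) & desubst k (phase y) (renorm y) y].
Proof. exact: projT2 (cid desubst_choice) y. Qed.

Lemma renorm_uniq i z y : toeplitz k y -> toeplitz k z -> (i < k.+3)%N ->
  desubst k i z y -> phase y = i /\ renorm y = z.
Proof.
move=> Ty Tz ik yz; have [pk Tr yr] := renormP Ty.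
have E : phase y = i by exact: desubst_phase pk ik Tz yr yz _.
split => //; apply: funext => q; rewrite E in yr.
exact: desubst_eq yr yz q.
Qed.

Local Notation XV := (rank1_shift (toeplitz_word k)).
Local Notation T := (@rank1_map (toeplitz_word k)).
Implicit Types x : XV.

Lemma frame_choice : exists F : XV -> nat * (int -> nat),
  forall x, frame (set_val x) (F x).1 (F x).2 /\ toeplitz k (F x).2.
Proof.
have ex x : exists F : nat * (int -> nat),
    frame (set_val x) F.1 F.2 /\ toeplitz k F.2.
  by have /rank1_shift_frame[i [y xy]] := set_valP x; exists (i, y).
by have [F FP] := choice ex; exists F.
Qed.

(** The run lengths of x seen from the origin, desubstituted n times; [digit] records the place of
    the origin in its run and then in the successive substituted words. *)
Definition level x (n : nat) : int -> nat :=
  iter n renorm (projT1 (cid frame_choice) x).2.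
Definition digit x (n : nat) : nat :=
  if n is m.+1 then phase (level x m) else (projT1 (cid frame_choice) x).1.

Lemma level0 x : frame (set_val x) (digit x 0) (level x 0).
Proof. exact: (projT2 (cid frame_choice) x).1. Qed.

Lemma level_toeplitz x n : toeplitz k (level x n).
Proof.
elim: n => [|n IH]; first exact: (projT2 (cid frame_choice) x).2.
by have [] := renormP IH.
Qed.

Lemma level_desubst x n : desubst k (digit x n.+1) (level x n.+1) (level x n).
Proof. by have [] := renormP (level_toeplitz x n). Qed.

Lemma digit_lt x n : (digit x n < k.+3)%N.
Proof.
case: n => [|n]; last by have [] := renormP (level_toeplitz x n).
have [le _] := level0 x; apply: leq_ltn_trans le _.
exact: ltnW (toeplitz_lt _ (level_toeplitz x 0)).
Qed.

Lemma frame_uniq (u : int -> bool) i y i' y' : frame u i y -> frame u i' y' ->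
  toeplitz k y -> i = i' /\ y = y'.
Proof.
move=> uy uy' Ty; have yk t : (y t < k.+2)%N by exact: toeplitz_lt.
have H K := @frame_window u i y u i' y' k.+2 K _ uy uy' yk (leqnn _) (fun _ _ => erefl).
split; first by have [] := H 0%N.
by apply: funext => t; have [_] := H `|t|%N; exact.
Qed.

Lemma level_frame x i y : frame (set_val x) i y -> digit x 0 = i /\ level x 0 = y.
Proof. by move=> xy; apply: frame_uniq (level0 x) xy (level_toeplitz x 0). Qed.

Lemma path_of_ex x : exists p, forall n, pl p n = level x n 0 /\ pd p n = digit x n.
Proof.
apply: path_exists => [n|n||n].
- exact: toeplitz_lt (level_toeplitz x n).
- exact: digit_lt.
- by have [] := level0 x.
- by rewrite -(level_desubst x n 0 (digit_lt x n.+1)) mulr0 add0r subrr.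
Qed.

Definition path_of x : path_set B := projT1 (cid (path_of_ex x)).

Lemma pl_path_of x n : pl (path_of x) n = level x n 0.
Proof. exact: (projT2 (cid (path_of_ex x)) n).1. Qed.
Lemma pd_path_of x n : pd (path_of x) n = digit x n.
Proof. exact: (projT2 (cid (path_of_ex x)) n).2. Qed.

Lemma level_window n K : exists M, forall x x', window M x x' ->
  digit x n = digit x' n /\ forall t : int, (`|t| <= K)%N -> level x n t = level x' n t.
Proof.
elim: n K => [|n IH] K.
  exists (k.+2 * K.+1)%N => x x' xx'.
  apply: frame_window (level0 x) (level0 x') _ (leqnn _) xx' => t.
  exact: toeplitz_lt (level_toeplitz x 0).
(* The first summand fixes the phase by [desubst_phase], the second the letters by
   [desubst_window]. *)
have [M HM] := IH (k.+3 * k.+3 + (k.+3 * K + k.+3))%N; exists M => x x' xx'.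
have [_ L] := HM x x' xx'.
have dE : digit x n.+1 = digit x' n.+1.
  apply: desubst_phase (digit_lt _ _) (digit_lt _ _) (level_toeplitz x' n.+1)
    (level_desubst x n) (level_desubst x' n) _ => t tK.
  by apply: L; apply: leq_trans tK _; exact: leq_addr.
split=> //; apply: desubst_window (digit_lt x n.+1) (level_desubst x n) _ _.
  by rewrite dE; exact: level_desubst.
by move=> t tK; apply: L; apply: leq_trans tK _; exact: leq_addl.
Qed.

Lemma path_of_continuous : continuous path_of.
Proof.
apply/(cylinder_continuous (window_basis k) (path_cylinder_basis B)) => x n.
elim: n => [|n [M IH]]; first by exists 0%N.
have [M' H] := level_window n 0; exists (maxn M M') => x' xx' i.
rewrite ltnS leq_eqVlt => /predU1P[->|i_n].
  have [|dE lE] := H x x'.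
    by apply: (cyl_mono (window_basis k)) xx'; exact: leq_maxr.
  by apply: path_edge_eq; rewrite ?pl_path_of ?pd_path_of//; exact: lE.
by apply: IH i_n; apply: (cyl_mono (window_basis k)) xx'; exact: leq_maxl.
Qed.

(** Edge n gives one letter at level n; each of the n substitutions down to level 0 adds a letter on
    both sides by [desubst_grow], and n letters cover radius n. *)
Lemma path_of_window n x x' :
  agree_below n.+1 (path_of x) (path_of x') -> window n x x'.
Proof.
move=> xx'.
have dE i : (i <= n)%N -> digit x i = digit x' i.
  by move=> i_n; rewrite -!pd_path_of /pd xx'.
suff H j : (j <= n)%N -> forall t : int, (`|t| <= j)%N ->
    level x (n - j) t = level x' (n - j) t.
  have := level0 x'; rewrite -dE// => x'0.
  by apply: frame_grow (level0 x) x'0 _; have := H n (leqnn n); rewrite subnn.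
elim: j => [|j IH] jn.
  move=> t; rewrite leqn0 absz_eq0 => /eqP ->; rewrite subn0.
  by rewrite -!pl_path_of /pl xx'.
have E : (n - j = (n - j.+1).+1)%N by lia.
apply: (@desubst_grow k (digit x (n - j)%N)) (digit_lt _ _) _ _ (IH (ltnW jn)).
  by rewrite E; exact: level_desubst.
by rewrite dE ?leq_subr// E; exact: level_desubst.
Qed.

(** The prefix of p prescribes the places at which z is to be substituted down to level 0. The
    freedom in z yields density of the image and, with a second choice of z, perfectness. *)
Lemma path_of_realize n p (z : int -> nat) : toeplitz k z -> z 0 = pl p n ->
  exists2 x, agree_below n.+1 (path_of x) p & level x n = z.
Proof.
elim: n z => [|n IH] z Tz z0.
  have [|u uz] := @frame_exists (pd p 0) z; first by rewrite z0 pd0_le.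
  have Xu : XV u by apply/rank1_shift_frame; exists (pd p 0), z.
  pose x : XV := exist _ (u : biseq) (mem_set Xu).
  have [xd xl] : digit x 0 = pd p 0 /\ level x 0 = z by exact: level_frame.
  exists x => // -[] // _; apply: path_edge_eq; first by rewrite pl_path_of xl.
  by rewrite pd_path_of.
have [y Ty yz] := subst_exists (pd_lt p n.+1) Tz.
have [|x xp xl] := IH y Ty.
  have := yz 0 (pd p n.+1) (pd_lt p n.+1).
  by rewrite mulr0 add0r subrr z0 -pl_subst.
have [xd xr] := renorm_uniq Ty Tz (pd_lt p n.+1) yz.
have xz : level x n.+1 = z by rewrite /level iterS -/(level x n) xl.
exists x => // i; rewrite ltnS leq_eqVlt => /predU1P[->|]; last exact: xp.
apply: path_edge_eq; first by rewrite pl_path_of xz.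
by rewrite pd_path_of /digit xl.
Qed.

Lemma rank1_shift_nonempty : exists u, XV u.
Proof.
have [u uy] := @frame_exists 0 (ruler k) isT.
by exists u; apply/rank1_shift_frame; exists 0%N, (ruler k); split => //; exact: toeplitz_ruler.
Qed.

Lemma path_of_homeomorphism : homeomorphism path_of.
Proof.
apply: (cylinder_homeomorphism (window_basis k) (path_cylinder_basis B)).
- exact: rank1_shift_compact.
- exact: path_of_continuous.
- by move=> n; exists n.+1 => x x'; exact: path_of_window.
- move=> p n; have [z Tz [z0 _]] := toeplitz_other (fun _ => 0%N) (pl_lt p n).
  have [x xp _] := path_of_realize Tz z0; exists x => i i_n.
  by apply: xp; exact: ltnW.
Qed.

Lemma rank1_shift_perfect : perfect_set [set: XV].
Proof.
apply/perfectTP => x; rewrite openE => /(_ x erefl).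
move=> /(cyl_nbhs (window_basis k))[n nx].
have [z Tz [z0 [t zt]]] := toeplitz_other (level x n) (toeplitz_lt 0 (level_toeplitz x n)).
have [|x' x'p x'z] := @path_of_realize n (path_of x) z Tz; first by rewrite pl_path_of.
have E : x' = x.
  by apply: nx; apply: path_of_window => i i_n; rewrite x'p.
by move/eqP: zt; apply; rewrite -x'z E.
Qed.

Lemma rank1_cantor_system : cantor_system T.
Proof.
split; [split| |].
- exact: rank1_shift_perfect.
- exact: rank1_shift_compact.
- exact: cylinder_hausdorff (window_basis k).
- exact: cylinder_zero_dimensional (window_basis k).
- exact: cylinder_metrizable (window_basis k).
- exact: rank1_map_homeomorphism.
Qed.

(** * The shift acts on digits as an odometer *)

Lemma digit_le_max x n : (digit x n <= pd_max (path_of x) n)%N.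
Proof.
case: n => [|n]; last by rewrite -ltnS; exact: digit_lt.
by rewrite /pd_max pl_path_of; have [] := level0 x.
Qed.

(** A maximal digit puts the origin at the last place of its word; the shift moves it to the start
    of the next word, which resets the digit and shifts the desubstituted sequence in turn. The
    clause for n = m+1 hands this shift to the next level. *)
Lemma digit_carry x n : (forall i, (i < n)%N -> digit x i = pd_max (path_of x) i) ->
  (forall i, (i < n)%N -> digit (T x) i = 0%N) /\
  (if n is m.+1 then level (T x) m = (fun t => level x m (t + 1)) else True).
Proof.
elim: n => [//|n IH] xm.
have [|d0 ln] := IH; first by move=> i i_n; apply: xm; exact: ltnW.
suff [dn ln1] : digit (T x) n = 0%N /\ level (T x) n = (fun t => level x n (t + 1)).
  by split=> // i; rewrite ltnS leq_eqVlt => /predU1P[->//|]; exact: d0.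
have := xm n (ltnSn n); case: n {IH xm d0} ln => [_|n ln] /= E.
  apply: level_frame; apply: frame_carry.
  by have := level0 x; rewrite [digit x 0]E pl_path_of.
have yz := level_desubst x n; rewrite [digit x n.+1]E in yz.
have Ts m : toeplitz k (fun t => level x m (t + 1)).
  have := toeplitz_shift 1 (level_toeplitz x m).
  rewrite (_ : (fun t => _ (1 + t)) = fun t => level x m (t + 1))//.
  by apply: funext => t; rewrite addrC.
rewrite ln; apply: (renorm_uniq (i := 0%N) (Ts n) (Ts n.+1) isT); exact: desubst_carry.
Qed.

Lemma digit_step x n : (forall i, (i < n)%N -> digit x i = pd_max (path_of x) i) ->
  (digit x n < pd_max (path_of x) n)%N ->
  digit (T x) n = (digit x n).+1 /\ level (T x) n = level x n.
Proof.
move=> xm; have [_] := digit_carry xm; case: n {xm} => [_|n ln] /= lt.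
  apply: level_frame; apply: frame_shift (level0 x) _.
  by rewrite pl_path_of in lt.
have Ts : toeplitz k (fun t => level x n (t + 1)).
  by rewrite -ln; exact: level_toeplitz.
rewrite ln; apply: renorm_uniq => //; first exact: (level_toeplitz x n.+1).
exact: desubst_shift (level_desubst x n).
Qed.

Lemma path_of_vershik x :
  (path_max (path_of x) -> path_min (path_of (T x))) /\
  (~ path_max (path_of x) -> vershik_step (path_of x) (path_of (T x))).
Proof.
split=> [xm n|xN].
  apply/edge_minP; rewrite pd_path_of.
  suff H i : digit x i = pd_max (path_of x) i.
    by have [d0 _] := @digit_carry x n.+1 (fun i _ => H i); exact: d0.
  by rewrite -pd_path_of; apply/edge_maxP; exact: xm.
have ex : exists n, digit x n != pd_max (path_of x) n.
  apply: contrapT => /forallNP H; apply: xN => n; apply/edge_maxP.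
  by rewrite pd_path_of; apply/eqP/negPn/negP; exact: H.
case: (ex_minnP ex) => n nN nmin.
have xm i : (i < n)%N -> digit x i = pd_max (path_of x) i.
  by move=> i_n; apply/eqP/negPn/negP => /nmin; lia.
have lt : (digit x n < pd_max (path_of x) n)%N.
  by rewrite ltn_neqAle nN digit_le_max.
have [d0 _] := digit_carry xm; have [dn ln] := digit_step xm lt.
have lE i : (n <= i)%N -> level (T x) i = level x i.
  move=> ni; rewrite -(subnK ni); move: (i - n)%N => j.
  elim: j => [//|j IH].
  by rewrite addSn -[LHS]/(renorm (level (T x) (j + n))) IH.
exists n; split.
- by move=> /edge_maxP; rewrite pd_path_of => /eqP; exact/negP.
- by move=> i i_n; apply/edge_maxP; rewrite pd_path_of xm.
- by apply: edge_succP; rewrite ?pl_path_of ?pd_path_of ?ln.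
- by move=> i i_n; apply/edge_minP; rewrite pd_path_of d0.
- move=> i ni; apply: path_edge_eq; first by rewrite !pl_path_of lE// ltnW.
  by rewrite !pd_path_of; case: i ni => // i ni; rewrite /digit lE.
Qed.

Lemma rank1_topological_rank_le : topological_rank_le T k.+2.
Proof.
split; [exact: rank1_cantor_system|exact: rank1_essentially_minimal rank1_shift_nonempty|].
have [phiC [psi [psiC phiK psiK]]] := path_of_homeomorphism.
exists B, (fun p => path_of (T (psi p))); split.
- exact: tdiagram_essentially_simple.
- by move=> p; have := path_of_vershik (psi p); rewrite psiK.
- by exists path_of; [exact: path_of_homeomorphism|move=> x; rewrite phiK].
- by move=> n; rewrite card_ord.
Qed.

Lemma rank1_topological_rank_ge d : topological_rank_le T d -> (k.+2 <= d)%N.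
Proof.
move=> Td; rewrite leqNgt; apply/negP => dk.
pose f (j : 'I_k.+2) x : rat := ((digit x 0 == 0%N) && (level x 0 0 == j))%:R.
have [|m [j mj] [C mC]] := topological_rank_sums (f := f) Td dk.
  move=> j x; have [M H] := level_window 0 0.
  apply/(cyl_nbhs (window_basis k)); exists M => x' xx' /=.
  by have [dE lE] := H x x' xx'; rewrite /f -dE -lE.
(* The combination is extended by 0 outside X_V, since [frame_sums] speaks of functions on all
   bi-infinite words. *)
pose G (u : int -> bool) : rat := if pselect (XV u) is left Xu then
  \sum_j m j * f j (exist _ (u : biseq) (mem_set Xu)) else 0.
have GE u i y : frame u i y -> toeplitz k y ->
    G u = if i == 0%N then m (inord (y 0)) else 0.
  move=> uy Ty; rewrite /G; case: pselect => [Xu|[]]; last first.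
    by apply/rank1_shift_frame; exists i, y.
  set x := exist _ _ _; have [xd xl] : digit x 0 = i /\ level x 0 = y.
    exact: level_frame.
  have yk := toeplitz_lt 0 Ty.
  rewrite (bigD1 (inord (y 0)))//= big1 ?addr0 => [|l ly].
    by rewrite /f xd xl inordK// eqxx andbT; case: eqP; rewrite ?mulr1 ?mulr0.
  rewrite /f xl (_ : (y 0 == l) = false) ?andbF ?mulr0//.
  by apply: contraNF ly => /eqP ->; rewrite inord_val.
have [P wP P0] := ruler_word_coding k.
have Tw : toeplitz k (fun t => ruler k (1 + t)) := toeplitz_shift 1 (toeplitz_ruler k).
have w0 : frame (ruler_word k) 0 (fun t => ruler k (1 + t)) by split => //; exists P.
have Xw : XV (ruler_word k) by apply/rank1_shift_frame; exists 0%N, (fun t => ruler k (1 + t)).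
pose x : XV := exist _ (ruler_word k : biseq) (mem_set Xw).
pose S (z : int -> bool) (i : int) := z (i + 1).
have Gx (t : nat) :
    G (iter t S (ruler_word k)) = \sum_j m j * f j (iter t T x).
  have -> : iter t S (ruler_word k) = set_val (iter t T x).
    by elim: t => // t IH; rewrite !iterS IH.
  rewrite /G; case: pselect => [Xu|[]]; last exact: set_valP.
  by apply: eq_bigr => l _; congr (_ * f l _); apply: val_inj.
have bounded (s : nat) : `|\sum_(u < s) m (inord (ruler k u.+1%:Z))| <= C.
  have [n nE] := frame_sums (m := fun i => m (inord i)) GE w0 Tw s.
  have -> : \sum_(u < s) m (inord (ruler k u.+1%:Z)) =
      \sum_(t < n) \sum_j m j * f j (iter t T x).
    transitivity (\sum_(u < s) m (inord (ruler k (1 + u%:Z)))).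
      by apply: eq_bigr => u _; rewrite -PoszD add1n.
    by rewrite -nE; apply: eq_bigr => t _; exact: Gx.
  exact: mC.
have := ruler_sums_bounded (m := fun i => m (inord i)) bounded (ltn_ord j).
by rewrite inord_val => /eqP; exact/negP.
Qed.

End Diagram.

Local Close Scope classical_set_scope.
Local Close Scope ring_scope.

Theorem proposition6p11 (N : nat) (hN : 1 < N) :
  exists V : nat -> bool,
    [/\ rank1_word V,
        minimal_subshift (rank1_shift V) &
        exists d : nat, topological_rank (@rank1_map V) d /\ N <= d].
Proof.
case: N hN => [|[|k]] // _; exists (toeplitz_word k); split.
- exact: rank1_toeplitz_word.
- exact: minimal_toeplitz_word.
(* Finiteness of the rank, by the diagram with k+2 vertices per level, makes the minimum exist. *)
have ex : exists d, `[< topological_rank_le (@rank1_map (toeplitz_word k)) d >].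
  by exists k.+2; apply/asboolP; exact: rank1_topological_rank_le.
case: (ex_minnP ex) => d /asboolP dT dmin; exists d; split.
  by split=> // d' /asboolP; exact: dmin.
exact: rank1_topological_rank_ge dT.
Qed.
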